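(* Let $\ell$ be an odd prime and let $V$ be a finite-dimensional vector space over $\mathbb{F}_\ell$ together with a non-degenerate bilinear pairing which is either symmetric or alternating; if the pairing is symmetric assume $\ell\geq 5$. Let $\Gamma\leq\mathrm{GL}(V)$ be the subgroup preserving the pairing. Let $r\geq 1$ be an integer and suppose $G\leq\Gamma$ is an irreducible subgroup together with a set of generators $S\subset G$ and a subset $S_0\subset S$ satisfying the following properties: (1) $\mathrm{drop}(\gamma)\leq r$ for every $\gamma\in S$; (2) every $\gamma\in S\setminus S_0$ has order prime to $(r+1)!$ or is a pseudoreflection; (3) $2(r+1)|S_0|\leq\dim(V)$. If the pairing is symmetric and $G$ contains a reflection and an isotropic shear, then $G$ is one of the following: (a) the full orthogonal group $O(V)$; (b) the kernel of the spinor norm on $O(V)$; (c) the kernel of the product of the spinor norm and the determinant on $O(V)$. If the pairing is alternating and $G$ contains a transvection, then $G$ is all of $\mathrm{Sp}(V)$.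
   Context: $\Gamma$ is denoted $O(V)$ if the pairing is symmetric and $\mathrm{Sp}(V)$ if it is alternating. For $\gamma\in\Gamma$, $\mathrm{drop}(\gamma)$ is the codimension in $V$ of the fixed space $V^{\gamma=1}$. An element $\gamma\in\Gamma$ of drop $1$ is called a pseudoreflection; it is a reflection if $\det(\gamma)=-1$ and a transvection if $\det(\gamma)=1$. An isotropic shear is a non-trivial unipotent element $\sigma\in\Gamma$ with $(\sigma-1)^2=0$. A subgroup $G\leq\Gamma$ is irreducible if $V$ is an irreducible $G$-representation. The spinor norm is the homomorphism $O(V)\to\mathbb{F}_\ell^\times/\mathbb{F}_\ell^{\times 2}\cong\{\pm1\}$ sending the reflection with root $v$ (a generator of its $(-1)$-eigenspace) to the class of $\langle v,v\rangle$; its product with the determinant is formed in $\{\pm1\}$. *)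

(* Defs.v *)
From HB Require Import structures.
From mathcomp Require Import all_boot all_order all_algebra all_fingroup.
From mathcomp Require Import all_solvable all_field all_character.
From mathcomp Require Import ring.

Set Implicit Arguments.
Unset Strict Implicit.
Unset Printing Implicit Defensive.

Import GRing.Theory.
Local Open Scope ring_scope.

(* V is the space 'rV[F]_n.+1 of row vectors, on which {'GL_n.+1[F]} acts by  *)
(* right multiplication; dim V = n.+1 > 0 because an irreducible              *)
(* representation is nonzero.                                                 *)
Section Pairing.

Variables (F : finFieldType) (n : nat) (B : {biscalar 'rV[F]_n.+1}).
Implicit Types (g h : {'GL_n.+1[F]}) (u v x : 'rV[F]_n.+1).

Definition pairing_symmetric := forall u v, B u v = B v u.

Definition pairing_alternating := forall u, B u u = 0.

Definition pairing_nondegenerate :=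
  forall u, (forall v, B u v = 0) -> u = 0.

Definition isom_set : {set {'GL_n.+1[F]}} :=
  [set g : {'GL_n.+1[F]} |
    [forall u : 'rV_n.+1, forall v : 'rV_n.+1,
       B (u *m GLval g) (v *m GLval g) == B u v]].

Lemma isomP g :
  reflect (forall u v, B (u *m GLval g) (v *m GLval g) = B u v)
          (g \in isom_set).
Proof.
rewrite inE; apply: (iffP forallP) => [H u v|H u].
  by apply/eqP; exact: (forallP (H u) v).
by apply/forallP => v; apply/eqP.
Qed.

Lemma isom_group_set : group_set isom_set.
Proof.
apply/group_setP; split=> [|g h /isomP Hg /isomP Hh].
  by apply/isomP => u v; rewrite GL_1E !mulmx1.
by apply/isomP => u v; rewrite GL_MxE !mulmxA Hh Hg.
Qed.

Canonical isom_group := Group isom_group_set.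

Definition drop_dim g : nat := (n.+1 - \rank (eigenspace (GLval g) 1%R))%N.

Definition pseudoreflection g := drop_dim g == 1%N.

Definition reflection g := pseudoreflection g && (\det (GLval g) == -1).

Definition transvection g := pseudoreflection g && (\det (GLval g) == 1).

(* The second condition already makes g unipotent. *)
Definition isotropic_shear g := (g != 1%g) && ((GLval g - 1%:M) ^+ 2 == 0).

Definition natural_repr (G : {group {'GL_n.+1[F]}}) :=
  subg_repr (GLrepr F n) (subsetT G).

(* The class of a nonzero scalar under the identification of                  *)
(* F^* / (F^* )^2 with {1, -1}, viewed inside F (for F of odd characteristic).*)
Definition sq_class (a : F) : F := if [exists b, a == b ^+ 2] then 1 else -1.

(* Values outside the isometry group are irrelevant. *)
Definition is_spinor_norm (theta : {ffun {'GL_n.+1[F]} -> F}) : bool :=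
  [&& [forall g in isom_set, (theta g == 1) || (theta g == -1)],
      [forall g in isom_set, forall h in isom_set,
         theta (g * h)%g == theta g * theta h]
    & [forall g in isom_set, forall v : 'rV_n.+1,
         reflection g && (eigenspace (GLval g) (-1) == v)%MS ==>
           (theta g == sq_class (B v v))]].

(* The default value is never used for a nondegenerate symmetric pairing in   *)
(* odd characteristic, by spinor_normP below; uniqueness on isom_set holds    *)
(* since reflections generate it (Cartan-Dieudonne).                          *)
Definition spinor_norm : {ffun {'GL_n.+1[F]} -> F} :=
  odflt [ffun=> 1] [pick theta | is_spinor_norm theta].

Definition ker_spinor : {set {'GL_n.+1[F]}} :=
  [set g in isom_set | spinor_norm g == 1].

Definition ker_spinor_det : {set {'GL_n.+1[F]}} :=
  [set g in isom_set | spinor_norm g * \det (GLval g) == 1].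

End Pairing.

Lemma odd_perm_invol_even (T : finType) (p : {perm T}) (m : T -> T) :
    involutive p -> involutive m -> (forall x, p (m x) = m (p x)) ->
    (forall x, p x != x -> (m x != x) && (p x != m x)) ->
  odd_perm p = false.
Proof.
move: {2}(#|_|) (leqnn #|[set x | p x != x]|) => k.
elim: k p => [|k IHk] p lepk pK mK pm pE.
  move: lepk; rewrite leqn0 cards_eq0 => /eqP fixp.
  suff -> : p = 1%g by rewrite odd_perm1.
  apply/permP => x; rewrite perm1; apply/eqP; apply/negPn.
  by have := in_set0 x; rewrite -fixp inE => ->.
have [fixp|[x]] := set_0Vmem [set x | p x != x].
  by apply: IHk; rewrite ?fixp ?cards0.
rewrite inE => px; pose y := p x; pose x' := m x; pose y' := m y.
have py : p y = x by rewrite /y pK.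
have px' : p x' = y' by rewrite /x' pm.
have py' : p y' = x' by rewrite /y' pm py.
have /andP[mx xy'] := pE _ px.
have nyx : y != x by [].
have nx'x : x' != x by [].
have nyx' : y != x' by [].
have ny'x' : y' != x' by rewrite (inj_eq (inv_inj mK)).
have ny'x : y' != x.
  by apply/eqP => E; case/eqP: nyx'; rewrite /x' -E /y' mK.
have ny'y : y' != y.
  have hy : p y != y by rewrite py eq_sym.
  by have /andP[] := pE _ hy.
pose q := (tperm x y * (tperm x' y' * p))%g.
have qE z : q z = if z \in [:: x; y; x'; y'] then z else p z.
  rewrite !permM !inE; case: (tpermP x y z) => [->|->|/eqP zx /eqP zy].
  - by rewrite eqxx tpermD ?py // eq_sym.
  - by rewrite eqxx orbT tpermD // eq_sym.
  - rewrite (negPf zx) (negPf zy) /=.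
    case: (tpermP x' y' z) => [->|->|/eqP zx' /eqP zy'].
    + by rewrite eqxx py'.
    + by rewrite eqxx orbT px'.
    + by rewrite (negPf zx') (negPf zy').
have mS z : (m z \in [:: x; y; x'; y']) = (z \in [:: x; y; x'; y']).
  rewrite !inE /x' /y' !(inj_eq (inv_inj mK)).
  rewrite -!(can2_eq mK mK).
  by rewrite orbC -!orbA; do !bool_congr.
have pS z : (p z \in [:: x; y; x'; y']) = (z \in [:: x; y; x'; y']).
  rewrite !inE !(can2_eq pK pK) py px' py' -/y.
  by do 4!case: (_ == _).
suff : odd_perm q = false.
  by rewrite !odd_permM !odd_tperm ![_ == y]eq_sym ![_ == y']eq_sym nyx ny'x' /= negbK.
apply: IHk => [||//|z|z].
- rewrite -ltnS; apply: leq_trans lepk; apply: proper_card.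
  apply/properP; split.
    apply/subsetP => z; rewrite !inE qE; case: ifP => //; by rewrite eqxx.
  by exists x; rewrite !inE // qE inE !eqxx.
- move=> z; rewrite [q z]qE; case: ifP => Hz; first by rewrite qE Hz.
  by rewrite qE pS Hz pK.
- by rewrite !qE mS; case: ifP => // _; rewrite pm.
- by rewrite qE; case: ifP => [_|_]; [rewrite eqxx | exact: pE].
Qed.

Lemma nonsquare_rep (F : finFieldType) : (2%:R : F) != 0 ->
  exists2 c : F, (forall b, c != b ^+ 2) &
    forall a, a != 0 -> (exists b, a = b ^+ 2) \/ (exists b, a = c * b ^+ 2).
Proof.
move=> two.
have /cyclicP[z zE] := field_unit_group_cyclic [set: {unit F}]%G.
have gen (a : F) : a != 0 -> exists k, a = val z ^+ k.
  move=> a0; have ua : a \is a GRing.unit by rewrite unitfE.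
  have : Sub a ua \in <[z]>%g by rewrite -zE inE.
  case/cycleP => k /(congr1 val) /= ->; exists k.
  by rewrite FinRing.val_unitX.
have cov a : a != 0 ->
    (exists b, a = b ^+ 2) \/ (exists b, a = val z * b ^+ 2).
  move=> /gen[k ->]; rewrite -(odd_double_half k).
  case: (odd k); [right|left]; exists (val z ^+ k./2).
    by rewrite add1n exprS -exprM muln2.
  by rewrite add0n -exprM muln2.
exists (val z) => // b; apply/eqP => zb.
have sq (a : F) : exists b, b ^+ 2 == a.
  have [->|/cov[[d ->]|[d ->]]] := eqVneq a 0.
  - by exists 0; rewrite expr0n.
  - by exists d.
  - by exists (b * d); rewrite exprMn zb.
pose s (a : F) := xchoose (sq a).
have sK : cancel s (fun x => x ^+ 2) by move=> a; apply/eqP/(xchooseP (sq a)).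
have [t st ts] : bijective s by apply: injF_bij; exact: can_inj sK.
have inj (x y : F) : x ^+ 2 = y ^+ 2 -> x = y.
  by rewrite -(ts x) -(ts y) !sK => ->.
have /inj/eqP : (1 : F) ^+ 2 = (-1) ^+ 2 by rewrite sqrrN.
by rewrite -subr_eq0 opprK -mulr2n (negPf two).
Qed.

Section SpinorNormExists.
Variables (F : finFieldType) (n : nat) (B : {biscalar 'rV[F]_n.+1}).
Hypotheses (two : (2%:R : F) != 0) (symB : pairing_symmetric B).
Hypothesis ndB : pairing_nondegenerate B.
Implicit Types (g h : {'GL_n.+1[F]}) (u v x : 'rV[F]_n.+1).

Lemma pseudoreflection_isomE g :
  g \in isom_set B -> pseudoreflection g ->
  exists w : 'rV[F]_n.+1, B w w != 0 /\
    forall x : 'rV[F]_n.+1,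
      x *m GLval g = x - (2%:R * B x w / B w w) *: w.
Proof.
move=> /isomP gB; rewrite /pseudoreflection /drop_dim => /eqP dr.
pose N : 'M[F]_n.+1 := GLval g - 1%:M.
have rN : \rank N = 1%N.
  by rewrite -dr /eigenspace mxrank_ker subKn // rank_leq_row.
have xg (x : 'rV[F]_n.+1) : x *m GLval g = x + x *m N by rewrite mulmxBr mulmx1 addrC subrK.
pose w : 'rV[F]_n.+1 := castmx (rN, erefl) (row_base N).
have xN (x : 'rV[F]_n.+1) : exists a : F, x *m N = (a *: w : 'rV[F]_n.+1).
  have : (x *m N <= w)%MS.
    by rewrite eqmx_cast eq_row_base submxMl.
  by case/sub_rVP => a ->; exists a.
have [f fE] : exists f : 'rV[F]_n.+1 -> F, forall x : 'rV[F]_n.+1, x *m N = f x *: w.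
  by have [f fE] := fin_all_exists xN; exists f.
have [x0 fx0] : exists x : 'rV[F]_n.+1, f x != 0.
  apply/existsP; apply: contraT; rewrite negb_exists => /forallP f0.
  have : \rank N == 0%N.
    rewrite mxrank_eq0; apply/eqP/row_matrixP => i.
    by rewrite row0 rowE fE; move: (f0 (delta_mx 0 i)); rewrite negbK => /eqP ->; rewrite scale0r.
  by rewrite rN.
have w0 : w != 0.
  apply/eqP => w0; have : \rank N == 0%N; last by rewrite rN.
  by rewrite mxrank_eq0; apply/eqP/row_matrixP => i; rewrite row0 rowE fE w0 scaler0.
have key x : f x != 0 -> 2%:R * B x w = - (f x * B w w).
  move=> fx; have := gB x x; rewrite xg fE.
  have -> : B (x + f x *: w) (x + f x *: w) =
     B x x + f x * B w x + (f x * B x w + f x * (f x * B w w)).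
    by rewrite linearDr !linearDl !linearZr_LR !linearZl_LR /=; ring.
  rewrite (symB w x) => /eqP; rewrite -subr_eq0 => /eqP E.
  apply: (mulfI fx); apply/eqP; rewrite -subr_eq0 -E; apply/eqP.
  by rewrite mulr_natl; ring.
have fD x : f x = 0 -> f (x + x0) = f x0.
  move=> fx; have := fE (x + x0); rewrite mulmxDl !fE fx scale0r add0r.
  move/eqP; rewrite -subr_eq0 -scalerBl scaler_eq0 (negPf w0) orbF subr_eq0.
  by move/eqP.
have key0 x : f x = 0 -> B x w = 0.
  move=> fx; have := key (x + x0); rewrite fD // => /(_ fx0).
  rewrite linearDl mulrDr /= (key _ fx0) => /eqP.
  by rewrite -subr_eq0 addrK mulf_eq0 (negPf two) => /eqP.
have wn0 : B w w != 0.
  apply: contraNneq w0 => bw; apply/eqP/ndB => x; rewrite symB.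
  have [/key0 //|/key] := eqVneq (f x) 0.
  by rewrite bw mulr0 oppr0 => /eqP; rewrite mulf_eq0 (negPf two) => /eqP.
exists w; split=> // x; rewrite xg fE -scaleNr; congr (_ + _ *: _).
have [fx|/key ->] := eqVneq (f x) 0; first by rewrite fx key0 // mulr0 mul0r oppr0.
by rewrite mulNr mulfK // opprK.
Qed.

(* The spinor norm of g is the signature of g acting on the quadric            *)
(* {x | B x x = c}, for c a nonsquare of F.                                   *)
Lemma spinor_norm_exists : exists theta, is_spinor_norm B theta.
Proof.
have [c cns cov] := nonsquare_rep two.
pose act g x : 'rV[F]_n.+1 := if B x x == c then x *m GLval g else x.
have actq g x : g \in isom_set B -> B (act g x) (act g x) = B x x.
  by move=> /isomP gB; rewrite /act; case: ifP.
have Pex g : exists p : {perm 'rV[F]_n.+1},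
    g \in isom_set B -> forall x, p x = act g x.
  have [gB|_] := boolP (g \in isom_set B); last by exists 1%g.
  have inj : injective (act g).
    move=> x y E; have Exy : B x x = B y y by rewrite -(actq g x) // E actq.
    move: E; rewrite /act Exy; case: ifP => // _.
    exact: (can_inj (mulmxK (GL_unitmx g))).
  by exists (perm inj) => _ x; rewrite permE.
have [P PE] := fin_all_exists Pex.
exists [ffun g => (-1) ^+ odd_perm (P g)].
apply/and3P; split.
- apply/forall_inP => g _; rewrite ffunE.
  by case: (odd_perm _); rewrite ?expr1 ?expr0 eqxx ?orbT.
- apply/forall_inP => g gB; apply/forall_inP => h hB; rewrite !ffunE.
  have -> : P (g * h)%g = (P g * P h)%g.
    apply/permP => x; rewrite permM !PE ?(groupM gB hB) //.
    rewrite {1 2}/act actq //; case: ifP => Hx; last by rewrite /act Hx.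
    by rewrite /act Hx GL_MxE mulmxA.
  by rewrite odd_permM signr_addb.
apply/forall_inP => g gB; apply/forallP => v; apply/implyP => /andP[/andP[gr _] ev].
rewrite ffunE; have [w [w0 wE]] := pseudoreflection_isomE gB gr.
have two' : B w w / B w w = 1 by rewrite divff.
have gg (x : 'rV[F]_n.+1) : x *m GLval g *m GLval g = x.
  rewrite !wE linearBl linearZl_LR /= -addrA -opprD -scalerDl.
  rewrite [X in X *: w](_ : _ = 0) ?scale0r ?subr0 //.
  by field.
have evP (x : 'rV[F]_n.+1) : x *m GLval g = - x <-> exists a, x = a *: v.
  split.
    move=> xg; have : (x <= eigenspace (GLval g) (-1))%MS.
      by apply/eigenspaceP; rewrite scaleN1r.
    by rewrite (eqmxP ev) => /sub_rVP.
  case=> a ->; have : (a *: v <= eigenspace (GLval g) (-1))%MS.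
    by rewrite (eqmxP ev) scalemx_sub.
  by move/eigenspaceP; rewrite scaleN1r.
have wg : w *m GLval g = - w.
  by rewrite wE -mulrA two' mulr1 scaler_nat mulr2n opprD addNKr.
have [a wv] := (evP w).1 wg.
have a0 : a != 0 by apply: contraNneq w0 => a0; rewrite wv a0 scale0r linear0l.
have Bvv t : B (t *: v) (t *: v) = t ^+ 2 * B v v.
  by rewrite linearZl_LR linearZr_LR /=; ring.
have v0 : B v v != 0.
  by apply: contraNneq w0 => v0; rewrite wv Bvv v0 mulr0.
pose m (x : 'rV[F]_n.+1) := - x.
have mK : involutive m by move=> x; rewrite /m opprK.
have BN x : B (- x) (- x) = B x x by rewrite linearNl linearNr opprK.
have pK : involutive (P g).
  move=> x; rewrite !PE // {1}/act actq //; case: ifP => Hx; rewrite /act Hx //.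
have pm x : P g (m x) = m (P g x).
  by rewrite !PE // /act /m BN; case: ifP => // _; rewrite mulNmx.
have mn x : P g x != x -> m x != x.
  rewrite PE // /act; case: ifP => [_ xx|]; last by rewrite eqxx.
  apply: contraNneq xx => /eqP; rewrite /m eq_sym -subr_eq0 opprK -mulr2n -scaler_nat.
  by rewrite scaler_eq0 (negPf two) => /eqP ->; rewrite mul0mx.
have pmx x : P g x = m x -> P g x != x -> B x x == c /\ exists t, x = t *: v.
  rewrite PE // /act; case: ifP => [_ xx _|_ _]; last by rewrite eqxx.
  by split=> //; apply/evP.
rewrite /sq_class; case: (boolP [exists b, _]) => [/existsP[b /eqP bE]|nb].
  rewrite (@odd_perm_invol_even _ _ m) // => x Hx; rewrite mn //=.
  apply/eqP => /pmx /(_ Hx)[/eqP Bx [t xt]]; have := cns (t * b).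
  by rewrite -Bx xt Bvv bE exprMn eqxx.
have [b bE] : exists b, B v v = c * b ^+ 2.
  case: (cov _ v0) => [[b bE]|//].
  by move/negP: nb; case; apply/existsP; exists b; apply/eqP.
have b0 : b != 0 by apply: contraNneq v0 => b0; rewrite bE b0 expr0n mulr0.
pose x0 := b^-1 *: v.
have Bx0 : B x0 x0 = c.
  by rewrite Bvv bE; field.
have px0 : P g x0 = - x0.
  by rewrite PE // /act Bx0 eqxx; apply/evP; exists b^-1.
have nx0 : x0 != - x0.
  apply/eqP => E; have /eqP : x0 *+ 2 = 0 by rewrite mulr2n {1}E addNr.
  rewrite -scaler_nat scaler_eq0 (negPf two) => /eqP x00.
  by move: (cns 0); rewrite -Bx0 x00 linear0l expr0n eqxx.
have pNx0 : P g (- x0) = x0 by rewrite -[- x0]/(m x0) pm px0 /m opprK.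
pose q := (tperm x0 (- x0) * P g)%g.
suff oq : odd_perm q = false.
  by move: oq; rewrite odd_permM odd_tperm nx0 /= => /negbFE ->.
have qE z : q z = if (z == x0) || (z == - x0) then z else P g z.
  rewrite permM; case: (tpermP x0 (- x0) z) => [->|->|/eqP zx /eqP zy].
  - by rewrite eqxx.
  - by rewrite eqxx orbT.
  - by rewrite (negPf zx) (negPf zy).
apply: (@odd_perm_invol_even _ _ m) => // [z|z|z].
- rewrite [q z]qE; case: ifP => Hz; first by rewrite qE Hz.
  rewrite qE !(can2_eq pK pK) px0 pNx0 orbC Hz pK //.
- rewrite !qE /m eqr_opp eqr_oppLR orbC.
  by case: ifP => // _; exact: pm.
- rewrite qE; case: ifP => [_|Hz Pz]; first by rewrite eqxx.
  rewrite mn //=; apply/eqP => /pmx /(_ Pz)[/eqP Bz [t zt]].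
  have : (t * b) ^+ 2 = 1.
    have c0 : c != 0 by apply: contraNneq (cns 0) => ->; rewrite expr0n.
    apply: (mulfI c0); rewrite mulr1 -[RHS]Bz zt Bvv bE; ring.
  move/eqP; rewrite -(expr1n _ 2) eqf_sqr => /orP[]/eqP tb.
    by move: Hz; rewrite zt /x0 (_ : t = b^-1) ?eqxx //; apply: (mulIf b0); rewrite mulVf.
  move: Hz; rewrite zt /x0 (_ : t = - b^-1) ?scaleNr ?eqxx ?orbT //.
  by apply: (mulIf b0); rewrite mulNr mulVf.
Qed.

Lemma spinor_normP : is_spinor_norm B (spinor_norm B).
Proof.
rewrite /spinor_norm; case: pickP => //= no.
by have [theta] := spinor_norm_exists; rewrite no.
Qed.

End SpinorNormExists.

(* Main.v *)
Require Import Defs.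
From HB Require Import structures.
From mathcomp Require Import all_boot all_order all_algebra all_fingroup.
From mathcomp Require Import all_solvable all_field all_character.
From mathcomp Require Import ring.

Set Implicit Arguments.
Unset Strict Implicit.
Unset Printing Implicit Defensive.

Import GRing.Theory.

(** Both cases follow the same pattern.  Let [Phi] be the set of roots of [G]: the
    centres of its transvections when the pairing is alternating, and when it is
    symmetric the vectors of a fixed nonzero norm [c] in which [G] contains the
    reflection.  The set [Phi] is stable under the irreducible group [G], so it
    spans the space.

    Link two roots when they are not orthogonal.  The components of this graph span
    mutually orthogonal blocks that [G] permutes transitively.  An element that
    permutes blocks in long cycles has a large drop, and this is where the
    hypotheses on generators enter ([Phi_connected]): when blocks are not lines, the
    generators outside [S0] fix all blocks, and those of [S0] move too few of them
    to act transitively.  So the graph is connected.  Blocks are not lines because a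
    centre and a neighbour of it are independent; in the symmetric case the
    isotropic shear provides two independent linked roots.

    In the alternating case a connected spanning set of centres, closed under its
    own transvections, contains every nonzero vector ([all_centres]), and
    transvections generate the symplectic group ([isom_group_transvections]).

    In the symmetric case the shear moves a root [v] to [v + w] with [w] singular
    and orthogonal to [v].  The product of the two reflections is a Siegel
    transformation of [w] along [v].  Starting from it one obtains a hyperbolic pair
    [w], [w'] and the Siegel transformations of both vectors along more and more
    directions, until connectedness shows that all directions orthogonal to the pair
    occur ([root_set_transitive]).  These transformations are transitive on the
    vectors of each nonzero norm.  Hence [G] contains all reflections of norm [c],
    and these generate a normal subgroup [N] such that all other reflections lie in
    one coset of [N].  As the isometry group is generated by reflections
    ([Cartan_Dieudonne]), [N] has index at most 2, so [G] is the isometry group or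
    [N], and by the same argument [N] is the kernel of the spinor norm or of its
    product with the determinant, whichever contains the reflections of norm [c]. *)

(** * Subgroups with an involution coset *)

Section Cosets.

Variable gT : finGroupType.
Implicit Types (A : {set gT}) (N K : {group gT}) (g h s : gT).

Lemma gen_conj_closed A h :
  (forall k, k \in A -> (k ^ h)%g \in A) -> forall g, g \in <<A>>%g -> (g ^ h)%g \in <<A>>%g.
Proof.
move=> Ah g gA; have hN : h \in 'N(A)%g.
  rewrite inE; apply/subsetP => k; rewrite mem_conjg => /Ah.
  by rewrite conjgKV.
by rewrite memJ_norm //; apply: subsetP hN; apply: norms_gen.
Qed.

(** The element is [k^-1 * k ^ s], because [s] is its own inverse. *)
Lemma involution_conj_coset N s k :
    (s * s = 1)%g -> (forall j, j \in N -> (j ^ s)%g \in N) -> k \in N ->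
  (s ^ k * s)%g \in N.
Proof.
move=> ss Ns kN; have sV : (s^-1 = s)%g by apply: (mulgI s); rewrite mulgV ss.
have -> : (s ^ k * s = k^-1 * k ^ s)%g by rewrite /conjg sV !mulgA.
by rewrite groupM ?groupV ?Ns.
Qed.

Lemma involution_cosets_group_set (A N : {group gT}) s :
    (s * s = 1)%g -> (forall k, k \in N -> (k ^ s)%g \in N) ->
  group_set [set h in A | (h \in N) || ((h * s)%g \in N)].
Proof.
move=> ss Ns'; have sV : (s^-1 = s)%g by apply: (mulgI s); rewrite mulgV ss.
have Ns k : k \in N -> (s * k * s)%g \in N.
  by move/Ns'; rewrite /conjg sV mulgA.
apply/group_setP; split=> [|h k]; first by rewrite inE !group1.
rewrite !inE => /andP[hA hN] /andP[kA kN]; rewrite groupM //=.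
case/orP: hN => hN; case/orP: kN => kN.
- by rewrite groupM.
- by rewrite -mulgA (groupM hN kN) orbT.
- have -> : (h * k * s = (h * s) * (s * k * s))%g.
    by rewrite !mulgA -(mulgA h s s) ss mulg1.
  by rewrite (groupM hN) ?Ns ?orbT.
have -> : (h * k = (h * s) * (s * (k * s) * s))%g.
  by rewrite !mulgA -(mulgA h s s) ss mulg1 -(mulgA _ s s) ss mulg1.
by rewrite (groupM hN) ?Ns.
Qed.

Lemma eq_of_two_cosets A N K s :
    K \subset A -> N \subset K -> (forall g, g \in A -> (g \in N) || ((g * s)%g \in N)) ->
  K :=: if s \in K then A else N.
Proof.
move=> KA NK AN; apply/eqP; rewrite eqEsubset; case: ifP => sK.
  rewrite KA; apply/subsetP => g /AN/orP[|gs]; first exact: subsetP.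
  by rewrite -(groupMr _ sK) (subsetP NK).
rewrite NK andbT; apply/subsetP => g gK; case/orP: (AN g (subsetP KA _ gK)) => // gs.
by rewrite -(groupMl _ gK) (subsetP NK) in sK.
Qed.

End Cosets.

(** * Membership in matrix groups *)

Section MatrixGroups.

Variables (F : finFieldType) (n : nat).
Implicit Types (H : {group {'GL_n.+1[F]}}) (g h : {'GL_n.+1[F]}) (i j : nat).

Lemma GL_groupM H g h : g \in H -> h \in H -> (g * h)%g \in H.
Proof. exact: groupM. Qed.

Lemma GL_groupV H g : g \in H -> (g^-1)%g \in H.
Proof. by rewrite groupV. Qed.

Lemma GL_groupX H g i : g \in H -> (g ^+ i)%g \in H.
Proof. exact: groupX. Qed.

Lemma GL_group_cancelr H g h : h \in H -> (g * h)%g \in H -> g \in H.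
Proof. by move=> hH; rewrite groupMr. Qed.

End MatrixGroups.

(** * Row spans and the action on vectors *)

Section RowSpan.

Local Open Scope ring_scope.

Variables (F : finFieldType) (n : nat).
Implicit Types (u v x : 'rV[F]_n.+1) (g h : {'GL_n.+1[F]}) (i : nat).
Implicit Type D : {set 'rV[F]_n.+1}.

Definition act u g : 'rV[F]_n.+1 := u *m GLval g.

Lemma act1 u : act u 1%g = u.
Proof. by rewrite /act GL_1E mulmx1. Qed.

Lemma actM u g h : act u (g * h)%g = act (act u g) h.
Proof. by rewrite /act GL_MxE mulmxA. Qed.

Lemma actK g : cancel (act^~ g) (act^~ g^-1%g).
Proof. by move=> u; rewrite -actM mulgV act1. Qed.

Lemma actKV g : cancel (act^~ g^-1%g) (act^~ g).
Proof. by move=> u; rewrite -actM mulVg act1. Qed.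

Lemma act_expD u g i j : act u (g ^+ (i + j))%g = act (act u (g ^+ i)%g) (g ^+ j)%g.
Proof. by rewrite expgD actM. Qed.

Lemma act_expS u g i : act u (g ^+ i.+1)%g = act (act u (g ^+ i)%g) g.
Proof. by rewrite expgSr actM. Qed.

Lemma act_expSl u g i : act u (g ^+ i.+1)%g = act (act u g) (g ^+ i)%g.
Proof. by rewrite expgS actM. Qed.

Lemma act_exp_order u g : act u (g ^+ #[g])%g = u.
Proof. by rewrite expg_order act1. Qed.

Lemma act_exp_mod u g i : act u (g ^+ (i %% #[g]%g))%g = act u (g ^+ i)%g.
Proof. by rewrite expg_mod_order. Qed.

Definition span_set D : 'M[F]_n.+1 := (\sum_(u in D) <<u>>)%MS.

Lemma span_set_subP D m (M : 'M_(m, n.+1)) :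
  reflect (forall u, u \in D -> (u <= M)%MS) (span_set D <= M)%MS.
Proof.
by apply: (iffP sumsmx_subP) => sDM u /sDM; rewrite genmxE.
Qed.

Lemma mem_span_set D u : u \in D -> (u <= span_set D)%MS.
Proof. by move: u; apply/span_set_subP. Qed.

Lemma span_set_ind D (P : 'rV[F]_n.+1 -> Prop) :
    P 0 -> (forall a u x, u \in D -> P x -> P (a *: u + x)) ->
  forall x, (x <= span_set D)%MS -> P x.
Proof.
move=> P0 PD x /sub_sums_genmxP[a ->].
elim/big_rec: _ => // u y uD Py.
by rewrite [a u]mx11_scalar mul_scalar_mx; apply: PD.
Qed.

Lemma drop_dimE g : drop_dim g = \rank (GLval g - 1%:M).
Proof. by rewrite /drop_dim /eigenspace mxrank_ker subKn ?rank_leq_row. Qed.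

End RowSpan.

(** * Blocks and the generators of bounded drop *)

Section Blocks.

Local Open Scope ring_scope.

Variables (F : finFieldType) (n : nat) (B : {biscalar 'rV[F]_n.+1}).
Variables (G : {group {'GL_n.+1[F]}}) (Phi : {set 'rV[F]_n.+1}).

Hypothesis ndB : pairing_nondegenerate B.
Hypothesis orthoC : forall u v, B u v = 0 -> B v u = 0.
Hypothesis G_isom : G \subset isom_group B.
Hypothesis G_irr : forall U : 'M[F]_n.+1,
  (forall g, g \in G -> (U *m GLval g <= U)%MS) -> U != 0 -> (1%:M <= U)%MS.
Hypothesis PhiG : forall g u, g \in G -> u \in Phi -> act u g \in Phi.

Implicit Types (u v x : 'rV[F]_n.+1) (g h : {'GL_n.+1[F]}) (i : nat).
Implicit Type D : {set 'rV[F]_n.+1}.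

Lemma isom_act g u v : g \in G -> B (act u g) (act v g) = B u v.
Proof. by move=> /(subsetP G_isom)/Defs.isomP->. Qed.

(** The row space of a [G]-stable set is a [G]-submodule. *)
Lemma span_stable_full D u :
    (forall g v, g \in G -> v \in D -> act v g \in D) -> u \in D -> u != 0 ->
  forall x, (x <= span_set D)%MS.
Proof.
move=> DG uD u0 x; apply: submx_trans (submx1 x) _; apply: G_irr => [g gG|].
  rewrite sumsmxMr; apply/sumsmx_subP => v vD.
  by rewrite (eqmxMr _ (genmxE v)); apply/mem_span_set/(DG g v).
by apply/rowV0Pn; exists u; rewrite ?mem_span_set.
Qed.

Lemma span_orthogonal D x :
  (forall u, u \in D -> B u x = 0) ->
  forall y, (y <= span_set D)%MS -> B y x = 0.
Proof.
move=> Dx; apply: span_set_ind => [|a u y uD yx]; first by rewrite linear0l.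
by rewrite linearDl linearZl_LR /= Dx // yx mulr0 addr0.
Qed.

(** The connected components of this graph on [Phi] are the blocks.  Distinct blocks are
    orthogonal, so their spans would be the summands of an orthogonal
    decomposition of the space permuted by [G]; the aim of the section is to
    exclude that there is more than one. *)
Definition linked : rel 'rV[F]_n.+1 :=
  fun u v => [&& u \in Phi, v \in Phi & B u v != 0].

Local Notation "u ~~> v" := (connect linked u v) (at level 70).

Lemma linked_connect_sym : connect_sym linked.
Proof.
apply: sym_connect_sym => u v; rewrite /linked andbCA; do !congr (_ && _).
by apply/idP/idP; apply: contra => /eqP /orthoC ->.
Qed.

Lemma connect_act g u v : g \in G -> u ~~> v -> act u g ~~> act v g.
Proof.
move=> gG /connectP[p]; elim: p u => [|w p IHp] u /= => [_ ->|]; first exact: connect0.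
case/andP=> /and3P[uP wP uw] /IHp E /E; apply: connect_trans.
by apply: connect1; rewrite /linked !PhiG //= isom_act.
Qed.

Lemma connect_actE g u v : g \in G -> (act u g ~~> act v g) = (u ~~> v).
Proof.
move=> gG; apply/idP/idP; last exact: connect_act.
by move/(connect_act (GL_groupV gG)); rewrite !actK.
Qed.

Lemma connect_Phi u v : u ~~> v -> u \in Phi -> v \in Phi.
Proof.
move=> /connectP[p]; elim: p u => [|w p IHp] u /= => [_ -> //|].
by case/andP=> /and3P[_ wP _] /IHp E /E /(_ wP).
Qed.

Lemma unconnected_orthogonal u v :
  u \in Phi -> v \in Phi -> ~~ (u ~~> v) -> B u v = 0.
Proof.
move=> uP vP; apply: contraNeq => uv.
by apply: connect1; rewrite /linked uP vP.
Qed.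

(** A vector outside [Phi] is linked to itself only, so this forces nothing there. *)
Definition block_union D := forall u v, u \in D -> u ~~> v -> v \in D.

Hypothesis Phi_span : forall x, (x <= span_set Phi)%MS.

Lemma orth_Phi x : (forall u, u \in Phi -> B u x = 0) -> x = 0.
Proof.
move=> xP; apply: ndB => y; apply: orthoC.
exact: (span_orthogonal xP (Phi_span y)).
Qed.

(** If no part of [D] made of whole blocks is mapped into itself by [g], then [g]
    fixes no nonzero vector of the span of [D]: the blocks on which such a vector
    [x] has a nonzero component are detected by the [v] with [B v x != 0], they
    all lie in [D], and [g] permutes them.  Hence [g - 1] is injective on that
    span, whose dimension is therefore at most the drop of [g]. *)
Lemma block_union_rank g D :
    g \in G -> D \subset Phi -> block_union D ->
    (forall E : {set 'rV[F]_n.+1}, E \subset D -> block_union E ->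
       (forall u, u \in E -> act u g \in E) -> E = set0) ->
  (\rank (span_set D) <= drop_dim g)%N.
Proof.
move=> gG DP Dcl Dno; rewrite drop_dimE.
rewrite -(mxrank_mul_ker (span_set D) (GLval g - 1%:M)).
suff /eqP -> : (span_set D :&: kermx (GLval g - 1%:M))%MS == 0.
  by rewrite mxrank0 addn0; exact: mxrankM_maxr.
apply/rowV0P => x; rewrite sub_capmx => /andP[xD /sub_kermxP].
rewrite mulmxBr mulmx1 => /eqP; rewrite subr_eq0 => /eqP xg.
pose E := [set u in Phi | [exists v, (u ~~> v) && (B v x != 0)]].
apply: orth_Phi => u uP; apply/eqP; apply: contraT => ux.
suff E0 : E = set0.
  have : u \in E by rewrite inE uP; apply/existsP; exists u; rewrite connect0.
  by rewrite E0 inE.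
apply: Dno.
- apply/subsetP => v; rewrite inE => /andP[vP /existsP[w /andP[vw wx]]].
  apply: contraR wx => vD; apply/eqP/orthoC.
  apply: (span_orthogonal _ xD) => t tD; apply: unconnected_orthogonal.
  - exact: subsetP tD.
  - exact: connect_Phi vw vP.
  apply: contra vD => tw; apply: (Dcl t) => //; apply: connect_trans tw _.
  by rewrite linked_connect_sym.
- move=> v w; rewrite !inE => /andP[vP /existsP[t /andP[vt tx]]] vw.
  rewrite (connect_Phi vw vP); apply/existsP; exists t; rewrite tx andbT.
  by apply: connect_trans vt; rewrite linked_connect_sym.
move=> v; rewrite !inE => /andP[vP /existsP[w /andP[vw wx]]].
rewrite PhiG //; apply/existsP; exists (act w g).
by rewrite connect_act //= -xg -/(act x g) isom_act.
Qed.

(** A cycle of length [k] of [g] on blocks forces a drop of at least [k - 1], since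
    all blocks of the cycle but one satisfy [block_union_rank].  So [k <= r.+1],
    while [k] divides the order of [g], which is prime to [r.+1`!]. *)
Lemma coprime_order_fixes_block r g u :
    g \in G -> u \in Phi -> (drop_dim g <= r)%N -> coprime #[g]%g (r.+1)`! ->
  u ~~> act u g.
Proof.
move=> gG uP gr cog.
have gX i : (g ^+ i)%g \in G by exact: GL_groupX.
have ret : exists i, (0 < i)%N && (u ~~> act u (g ^+ i)%g).
  by exists #[g]%g; rewrite order_gt0 act_exp_order connect0.
have [k' /andP[k0 uk] kmin] := ex_minnP ret.
have mulk i : u ~~> act u (g ^+ (k' * i))%g.
  elim: i => [|i IHi]; first by rewrite muln0 act1 connect0.
  rewrite mulnS act_expD; apply: connect_trans IHi _.
  by rewrite connect_actE // gX.
have dvk : (k' %| #[g]%g)%N.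
  rewrite /dvdn; apply: contraT; rewrite -lt0n => m0.
  have : (k' <= #[g]%g %% k')%N; last by rewrite leqNgt ltn_mod k0.
  apply: kmin; rewrite m0 /=; have := act_exp_order u g.
  rewrite {1}(divn_eq #[g]%g k') mulnC act_expD => E; rewrite -[X in X ~~> _]E connect_actE ?gX //.
  by rewrite linked_connect_sym.
have [k1|k1] := leqP k' 1.
  have -> : g = (g ^+ k')%g by rewrite (_ : k' = 1%N) ?expg1 //; apply/eqP; rewrite eqn_leq k1.
  exact: uk.
suff kr : (k' <= r.+1)%N.
  have : (k' %| gcdn #[g]%g (r.+1)`!)%N by rewrite dvdn_gcd dvk dvdn_fact ?k0.
  by rewrite (eqP cog) dvdn1 => /eqP k'1; rewrite k'1 in k1.
have k'E : k' = k'.-1.+1 by rewrite prednK.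
rewrite k'E ltnS; apply: leq_trans gr.
pose D := [set v | [exists i : 'I_k'.-1, act u (g ^+ i)%g ~~> v]].
have DP v : reflect (exists2 i, (i < k'.-1)%N & act u (g ^+ i)%g ~~> v) (v \in D).
  rewrite inE; apply: (iffP existsP) => [[i iv]|[i lti iv]]; first by exists i.
  by exists (Ordinal lti).
have uX i : act u (g ^+ i)%g \in Phi by rewrite PhiG.
have sep i j : (i < j)%N -> (j < k')%N -> ~~ (act u (g ^+ i)%g ~~> act u (g ^+ j)%g).
  move=> ij jk; apply/negP; rewrite -(subnK (ltnW ij)) act_expD connect_actE // => uij.
  have : (k' <= j - i)%N by apply: kmin; rewrite subn_gt0 ij.
  by rewrite leqNgt (leq_ltn_trans (leq_subr _ _) jk).
apply: (@leq_trans (\rank (span_set D))); last first.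
  apply: block_union_rank => //.
  - by apply/subsetP => v /DP[i _ /connect_Phi]; apply.
  - by move=> v w /DP[i ik iv] vw; apply/DP; exists i => //; apply: connect_trans vw.
  move=> E ED Ecl Eg; apply/eqP; apply: contraT => /set0Pn[v vE].
  have gE j : act v (g ^+ j)%g \in E.
    by elim: j => [|j IHj]; rewrite ?act1 // act_expS Eg.
  have /DP[i ik iv] := subsetP ED _ vE.
  have /DP[j jk] := subsetP ED _ (gE (k'.-1 - i)%N).
  rewrite linked_connect_sym => jv.
  have := sep j k'.-1 jk; rewrite [X in (_ < X)%N]k'E ltnSn => /(_ isT)/negP[].
  rewrite linked_connect_sym; apply: connect_trans jv.
  by rewrite -{1}(subnKC (ltnW ik)) act_expD connect_actE.
(* The vectors u g^i, taken in distinct blocks, are independent: pairing them with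
   the translates of a neighbour v of u gives a scalar matrix. *)
have [v vP vu] : exists2 v, v \in Phi & B v u != 0.
  apply/exists_inP; apply: contraT; rewrite negb_exists_in => /forall_inP H.
  have u0 : u = 0 by apply: orth_Phi => v /H; rewrite negbK => /eqP.
  have := sep 0%N 1%N isT k1; rewrite u0 /act !mul0mx connect0 //.
have uv : u ~~> v by rewrite linked_connect_sym connect1 // /linked vP uP.
pose U := \matrix_(i < k'.-1) act u (g ^+ i)%g.
have <- : \rank U = k'.-1.
  apply/eqP/row_freeP.
  pose W : 'M_(n.+1, k'.-1) := \matrix_(a, j) (B (delta_mx 0 a) (act v (g ^+ j)%g) / B u v).
  exists W; have Buv : B u v != 0 by apply: contra vu => /eqP/orthoC ->.
  apply/matrixP => i j; rewrite !mxE.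
  transitivity (B (row i U) (act v (g ^+ j)%g) / B u v).
    rewrite [row i U in RHS]row_sum_delta linear_sumlz mulr_suml; apply: eq_bigr => a _.
    by rewrite !mxE linearZl_LR /= mulrA.
  rewrite rowK; have [->|/negPf ij] := eqVneq i j; first by rewrite isom_act // divff.
  have nn (a : 'I_k'.-1) : (a < k')%N by apply: leq_trans (ltn_ord a) _; exact: leq_pred.
  rewrite unconnected_orthogonal ?PhiG ?mul0r //; apply/negP => uij.
  have {}uij : act u (g ^+ i)%g ~~> act u (g ^+ j)%g.
    by apply: connect_trans uij _; rewrite connect_actE ?gX // linked_connect_sym.
  have [ltij|ltji|/val_inj E] := ltngtP (val i) (val j); last by rewrite E eqxx in ij.
  - by rewrite (negPf (sep _ _ ltij (nn j))) in uij.
  - by rewrite linked_connect_sym (negPf (sep _ _ ltji (nn i))) in uij.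
apply: mxrankS; apply/row_subP => i; rewrite rowK; apply/mem_span_set/DP.
by exists i => //; exact: connect0.
Qed.

(** A moved block has dimension at most the drop. *)
Lemma drop1_fixes_block g u :
    g \in G -> u \in Phi -> (drop_dim g <= 1)%N ->
    (exists2 v, u ~~> v & ~~ (v <= u)%MS) ->
  u ~~> act u g.
Proof.
move=> gG uP g1 [v uv nv]; apply: contraT => ug.
pose D := [set w | u ~~> w].
have : (\rank (span_set D) <= drop_dim g)%N.
  apply: block_union_rank => //.
  - by apply/subsetP => w; rewrite inE => /connect_Phi; apply.
  - by move=> w t; rewrite !inE => /connect_trans; apply.
  move=> E ED Ecl Eg; apply/eqP; apply: contraT => /set0Pn[w wE].
  have := subsetP ED _ (Eg w wE); have := subsetP ED _ wE; rewrite !inE => uw uwg.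
  by case/negP: ug; apply: connect_trans uwg _; rewrite connect_actE // linked_connect_sym.
move/leq_trans/(_ g1) => rD; case/negP: nv.
have u0 : u != 0.
  by apply: contraNneq ug => ->; rewrite /act mul0mx connect0.
have uD : (u <= span_set D)%MS by rewrite mem_span_set // inE connect0.
apply: submx_trans (_ : (v <= span_set D)%MS) _; first by rewrite mem_span_set // inE.
have := mxrank_leqif_sup uD; rewrite rank_rV u0 => - [l1 <-].
by rewrite eqn_leq l1 rD.
Qed.

(** Choose one block in each nontrivial cycle of [g] on blocks.  Their span has
    dimension at most the drop, by [block_union_rank], and together with the image
    of [g - 1] it contains every moved block. *)
Lemma moved_rank g :
    g \in G ->
  (\rank (span_set [set u in Phi | ~~ (u ~~> act u g)]) <= 2 * drop_dim g)%N.
Proof.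
move=> gG; set M := [set u in Phi | _].
have gX i : (g ^+ i)%g \in G by exact: GL_groupX.
pose orb u v := [exists i : 'I_#[g]%g, act u (g ^+ i)%g ~~> v].
have orbP u v : reflect (exists i, act u (g ^+ i)%g ~~> v) (orb u v).
  apply: (iffP existsP) => [[i iv]|[i iv]]; first by exists i.
  exists (Ordinal (ltn_pmod i (order_gt0 g))).
  by rewrite /= act_exp_mod.
have orb_refl u : orb u u by apply/orbP; exists 0%N; rewrite act1 connect0.
have orb_act u : orb u =1 orb (act u g).
  move=> v; apply/orbP/orbP => [[i iv]|[i iv]]; last first.
    by exists i.+1; rewrite act_expSl.
  exists (i + #[g]%g.-1)%N; rewrite -act_expSl -addnS prednK ?order_gt0 // addnC.
  by rewrite act_expD act_exp_order.
have orb_con u w : u ~~> w -> orb u =1 orb w.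
  move=> uw v; apply/orbP/orbP => -[i iv]; exists i; apply: connect_trans iv.
    by rewrite connect_actE // linked_connect_sym.
  by rewrite connect_actE.
pose rep u := odflt 0 [pick v | orb u v].
have repE u w : orb u =1 orb w -> rep u = rep w by move=> E; rewrite /rep (eq_pick E).
have rep_orb u : orb u (rep u).
  by rewrite /rep; case: pickP => //= /(_ u); rewrite orb_refl.
pose D := [set u in M | u ~~> rep u].
have DM : D \subset M by apply/subsetP => u; rewrite inE => /andP[].
have Mcl : block_union M.
  move=> u v; rewrite !inE => /andP[uP ug] uv; rewrite (connect_Phi uv uP).
  apply: contra ug => vg; apply: (connect_trans uv); apply: connect_trans vg _.
  by rewrite connect_actE // linked_connect_sym.
have Mg u i : u \in M -> act u (g ^+ i)%g \in M.
  rewrite !inE => /andP[uP ug]; rewrite PhiG //=; apply: contra ug.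
  by rewrite -act_expS act_expSl connect_actE.
have rD : (\rank (span_set D) <= drop_dim g)%N.
  apply: block_union_rank => //.
  - by apply: subset_trans DM _; apply/subsetP => u; rewrite inE => /andP[].
  - move=> u v /setIdP[uM ur] uv; rewrite inE (Mcl u) //=.
    rewrite -(repE u) ?orb_con //; last exact: orb_con.
    by apply: connect_trans ur; rewrite linked_connect_sym.
  move=> E ED Ecl Eg; apply/eqP; apply: contraT => /set0Pn[u uE].
  have /setIdP[uM ur] := subsetP ED _ uE; have /setIdP[_ ugr] := subsetP ED _ (Eg u uE).
  move: uM; rewrite inE => /andP[_ /negP[]]; apply: connect_trans ur _.
  by rewrite (repE _ _ (orb_act u)) linked_connect_sym.
pose I := GLval g - 1%:M : 'M_n.+1.
apply: (@leq_trans (\rank (I + span_set D)%MS)); last first.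
  rewrite mul2n -addnn; apply: leq_trans (mxrank_adds_leqif _ _) _.
  by rewrite leq_add // drop_dimE.
apply/mxrankS/span_set_subP => u uM.
have /orbP[i ir] := rep_orb u.
have uiD : act u (g ^+ i)%g \in D.
  rewrite inE Mg //= (_ : rep _ = rep u) //; apply: repE => v.
  by elim: i {ir} => [|i IHi]; rewrite ?act1 // act_expS -orb_act.
have : (act u (g ^+ i)%g - u <= I)%MS.
  elim: i {ir uiD} => [|i IHi]; first by rewrite act1 subrr sub0mx.
  rewrite act_expS -(subrK (act u (g ^+ i)%g) (act _ g)) -addrA addmx_sub //.
  by rewrite {1}/act -{2}[act u _]mulmx1 -mulmxBr submxMl.
move=> uI; rewrite -(subKr (act u (g ^+ i)%g) u) addmx_sub //.
  by apply: submx_trans (addsmxSr _ _); apply: mem_span_set.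
by rewrite -scaleN1r scalemx_sub //; apply: submx_trans (addsmxSl _ _).
Qed.

(** By irreducibility the orbit of [u] spans, so [v] cannot be orthogonal to all
    of it. *)
Lemma blocks_transitive u v :
  u \in Phi -> u != 0 -> v \in Phi -> v != 0 -> exists2 g, g \in G & act u g ~~> v.
Proof.
move=> uP u0 vP v0; apply/exists_inP; apply: contraR v0.
rewrite negb_exists_in => /forall_inP nuv; apply/eqP.
pose D := [set act u g | g in G].
have DG g w : g \in G -> w \in D -> act w g \in D.
  by move=> gG /imsetP[h hG ->]; apply/imsetP; exists (h * g)%g; rewrite ?GL_groupM ?actM.
have uD : u \in D by apply/imsetP; exists 1%g; rewrite ?act1.
apply: ndB => x; apply: orthoC; apply: (span_orthogonal _ (span_stable_full DG uD u0 x)).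
move=> w /imsetP[g gG ->]; apply: unconnected_orthogonal (nuv g gG) => //.
exact: PhiG.
Qed.

Variables (r : nat) (S S0 : {set {'GL_n.+1[F]}}).
Hypothesis S_gen : <<S>>%g = G.
Hypothesis S_drop : forall g, g \in S -> (drop_dim g <= r)%N.
Hypothesis S_order : forall g, g \in S :\: S0 ->
  coprime #[g]%g (r.+1)`! \/ pseudoreflection g.
Hypothesis S0_sub : S0 \subset S.
Hypothesis S0_card : (2 * r.+1 * #|S0| <= n.+1)%N.
Hypothesis Phi_n0 : 0 \notin Phi.

(** If some block is not a single line, then there is only one block.  All blocks
    have the same dimension, at least 2, hence generators outside [S0] fix every
    block.  If there are several blocks then, by transitivity, each of them is
    moved by a generator, so by an element of [S0]; as each generator moves blocks
    of total dimension at most [2 * r], the dimension of the space would be at most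
    [2 * r * #|S0|]. *)
Theorem Phi_connected :
    (exists u v, [/\ u \in Phi, u ~~> v & ~~ (v <= u)%MS]) ->
  forall u v, u \in Phi -> v \in Phi -> u ~~> v.
Proof.
case=> u0 [v0 [u0P uv0 nv0]].
have nz u : u \in Phi -> u != 0 by apply: contraTneq => ->.
have SG g : g \in S -> g \in G by rewrite -S_gen; apply: mem_gen.
have big u : u \in Phi -> exists2 v, u ~~> v & ~~ (v <= u)%MS.
  move=> uP; have [g gG ug] := blocks_transitive u0P (nz _ u0P) uP (nz _ uP).
  have gu : u ~~> act u0 g by rewrite linked_connect_sym.
  have [ngu|gu0] := boolP (~~ (act u0 g <= u)%MS); first by exists (act u0 g).
  exists (act v0 g); first by apply: connect_trans gu _; rewrite connect_actE.
  apply: contra nv0 => gv; rewrite -[v0](actK g) -[u0](actK g); apply: submxMr.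
  apply: submx_trans gv _; move: gu0; rewrite negbK => /mxrank_leqif_sup.
  by rewrite !rank_rV !nz ?PhiG // => -[_ <-].
have fix1 g u : g \in S :\: S0 -> u \in Phi -> u ~~> act u g.
  move=> gS uP; have /setDP[gS' _] := gS; case: (S_order gS) => [cog|/eqP g1].
    exact: coprime_order_fixes_block (SG _ gS') uP (S_drop gS') cog.
  by apply: drop1_fixes_block; rewrite ?SG ?g1 //; exact: big.
have [/exists_inP[u uP /forall_inP uS]|] :=
    boolP [exists u in Phi, forall g in S, u ~~> act u g].
  have uG g : g \in G -> u ~~> act u g.
    pose K := [set h in G | u ~~> act u h].
    suff : G \subset K by move=> /subsetP GK /GK; rewrite inE => /andP[].
    have gK : group_set K.
      apply/group_setP; split=> [|h k]; first by rewrite inE group1 act1 connect0.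
      rewrite !inE => /andP[hG uh] /andP[kG uk]; rewrite GL_groupM //= actM.
      by apply: connect_trans uk _; rewrite connect_actE.
    rewrite -S_gen -[K]/(gval (Group gK)) gen_subG; apply/subsetP => h hS.
    by rewrite inE SG //= uS.
  move=> v w vP wP; apply: (@connect_trans _ _ u); last first.
    have [g gG] := blocks_transitive uP (nz _ uP) wP (nz _ wP).
    by apply: connect_trans; apply: uG.
  rewrite linked_connect_sym.
  have [g gG] := blocks_transitive uP (nz _ uP) vP (nz _ vP).
  by apply: connect_trans; apply: uG.
rewrite negb_exists_in => /forall_inP noS.
pose M g := span_set [set u in Phi | ~~ (u ~~> act u g)].
have full : (1%:M <= \sum_(g in S0) M g)%MS.
  apply/row_subP => i; apply: submx_trans (Phi_span _) _; apply/span_set_subP => u uP.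
  have := noS u uP; rewrite negb_forall_in => /exists_inP[g gS ug].
  have g0 : g \in S0.
    by apply: contraR ug => g0; apply: fix1; rewrite // inE g0.
  by apply: (sumsmx_sup g) => //; apply: mem_span_set; rewrite inE uP.
have : (n.+1 <= \sum_(g in S0) 2 * r)%N.
  rewrite -{1}(mxrank1 F n.+1); apply: leq_trans (mxrankS full) _.
  apply: (@leq_trans (\sum_(g in S0) \rank (M g))).
    elim/big_rec2: _ => [|g k A _ IH]; first by rewrite mxrank0.
    by apply: leq_trans (mxrank_adds_leqif _ _) _; rewrite leq_add2l.
  apply: leq_sum => g gS0; have gS := subsetP S0_sub _ gS0.
  by apply: leq_trans (moved_rank (SG _ gS)) _; rewrite leq_mul2l S_drop.
rewrite sum_nat_const mulnC => le1.
have := leq_trans S0_card le1; case: (posnP #|S0|) le1 => [->|S0_gt0]; first by rewrite muln0.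
by rewrite leq_pmul2r // leq_pmul2l // ltnn.
Qed.

End Blocks.

(** * Bilinear forms *)

Section Bilinear.

Local Open Scope ring_scope.

Variables (F : finFieldType) (n : nat) (B : {biscalar 'rV[F]_n.+1}).
Implicit Types (u v x y : 'rV[F]_n.+1) (a : F).

Lemma bilDl x y v : B (x + y) v = B x v + B y v. Proof. exact: linearDl. Qed.
Lemma bilDr x y v : B v (x + y) = B v x + B v y. Proof. exact: linearDr. Qed.
Lemma bilZl a x v : B (a *: x) v = a * B x v. Proof. exact: linearZl_LR. Qed.
Lemma bilZr a x v : B v (a *: x) = a * B v x. Proof. exact: linearZr_LR. Qed.
Lemma bilNl x v : B (- x) v = - B x v. Proof. exact: linearNl. Qed.
Lemma bilNr x v : B v (- x) = - B v x. Proof. exact: linearNr. Qed.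
Lemma bil0l v : B 0 v = 0. Proof. exact: linear0l. Qed.
Lemma bil0r v : B v 0 = 0. Proof. exact: linear0r. Qed.

Definition bilE := (bilDl, bilDr, bilZl, bilZr, bilNl, bilNr, bil0l, bil0r).

Lemma span_not_orthogonal (D : {set 'rV[F]_n.+1}) x :
    pairing_nondegenerate B -> (forall y, (y <= span_set D)%MS) -> x != 0 ->
  exists2 u, u \in D & B x u != 0.
Proof.
move=> ndB D_span x0; apply/exists_inP; apply: contraR x0.
rewrite negb_exists_in => /forall_inP xD; apply/eqP/ndB => y.
move: y (D_span y); apply: span_set_ind => [|a u y uD xy]; first exact: bil0r.
by rewrite bilDr bilZr xy addr0; have := xD u uD; rewrite negbK => /eqP ->; rewrite mulr0.
Qed.

End Bilinear.

(** * Centres of transvections *)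

Section TransvectionCentres.

Local Open Scope ring_scope.

Variables (F : finFieldType) (n : nat) (B : {biscalar 'rV[F]_n.+1}).
Hypotheses (two : (2%:R : F) != 0) (altB : pairing_alternating B).
Hypothesis ndB : pairing_nondegenerate B.

Implicit Types (u v w x y z t : 'rV[F]_n.+1) (a : F).

Lemma alternating_antisym u v : B v u = - B u v.
Proof.
apply/eqP; rewrite eq_sym -subr_eq0; apply/eqP.
by have := altB (u + v); rewrite !bilE !altB add0r addr0 => E; rewrite -[RHS]oppr0 -E; ring.
Qed.

Variable T : {set 'rV[F]_n.+1}.
Hypothesis T_scale : forall a u, a != 0 -> u \in T -> a *: u \in T.
Hypothesis T_step : forall a u v,
  u \in T -> v \in T -> B u v != 0 -> u + a *: v \in T.
Hypothesis T_n0 : 0 \notin T.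
Hypothesis T_connected :
  forall u v, u \in T -> v \in T -> connect (linked B T) u v.
Hypothesis T_span : forall x, (x <= span_set T)%MS.

(** Along a path u - w - t - v that cannot be shortened, the sum [w + t] is a
    common neighbour of [u] and [v]; so distances in the graph are at most 2. *)
Lemma centre_common_neighbour u v : u \in T -> v \in T ->
  exists w, [/\ w \in T, B u w != 0 & B v w != 0].
Proof.
move=> uT vT; have /connectP[p] := T_connected uT vT.
elim: p u uT => [|w p IHp] u uT /= => [_ ->|/andP[/and3P[_ wT uw]]].
  have [w wT uw] : exists2 w, w \in T & B u w != 0.
    by apply: (span_not_orthogonal ndB T_span); apply: contraNneq T_n0 => <-.
  by exists w.
move=> pth lst; have [t [tT wt vt]] := IHp w wT pth lst.
have [ut|ut] := eqVneq (B u t) 0; last by exists t.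
have [vw|vw] := eqVneq (B v w) 0; last by exists w.
exists (w + t); rewrite !bilE ut vw addr0 add0r; split=> //.
by rewrite -[t]scale1r T_step.
Qed.

(** Go through u, u + w, u + w + v and subtract w at the end; each step adds a
    multiple of a centre that is not orthogonal to the current vector. *)
Lemma centre_add u v w : u \in T -> v \in T -> w \in T ->
  B u v = 0 -> B u w != 0 -> B v w != 0 -> B (u + v) w != 0 -> u + v \in T.
Proof.
move=> uT vT wT uv uw vw uvw.
have uwT : u + w \in T by rewrite -[w]scale1r T_step.
have uwvT : u + w + v \in T.
  rewrite -[v]scale1r T_step // bilDl uv add0r alternating_antisym oppr_eq0 //.
have -> : u + v = u + w + v + (-1) *: w by rewrite scaleN1r addrAC addrK.
by apply: T_step => //; rewrite addrAC bilDl altB addr0.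
Qed.

(** Only the case of a sum [u + v] orthogonal to the common neighbour [w] remains.
    All other combinations of [u] and [v] are then centres; replace [w] by a centre
    [t] that is not orthogonal to [u + v], and write [u + v] as a sum of two centres
    of the plane, neither of which is orthogonal to [t]. *)
Lemma centre_addr u v : u \in T -> v \in T -> u + v != 0 -> u + v \in T.
Proof.
move=> uT vT uv0.
have [uv|uv] := eqVneq (B u v) 0; last by rewrite -[v]scale1r T_step.
have [w [wT uw vw]] := centre_common_neighbour uT vT.
have [uvw|] := eqVneq (B (u + v) w) 0; last exact: centre_add.
have vwE : B v w = - B u w by move/eqP: uvw; rewrite bilDl addrC addr_eq0 => /eqP.
have combT a b : a != b -> a *: u + b *: v \in T.
  have [->|a0 ab] := eqVneq a 0; first by rewrite eq_sym scale0r add0r => /T_scale; apply.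
  have [->|b0] := eqVneq b 0; first by rewrite scale0r addr0 T_scale.
  apply: (centre_add (w := w)); rewrite ?T_scale // !bilE ?uv ?mulr0 ?mulf_neq0 //.
  by rewrite vwE mulrN -mulrBl mulf_neq0 // subr_eq0.
have [t tT B1] : exists2 t, t \in T & B (u + v) t = 1.
  have [t tT zt] := span_not_orthogonal ndB T_span uv0.
  by exists ((B (u + v) t)^-1 *: t); rewrite ?T_scale ?invr_eq0 // bilZr mulVf.
have [p ut] : exists p, B u t = p by exists (B u t).
have vt : B v t = 1 - p by rewrite -B1 bilDl ut; ring.
(* The two summands have pairings 2 and -1 with t, which are nonzero in odd
   characteristic and have sum 1. *)
have u'T : (3%:R - p) *: u + (2%:R - p) *: v \in T.
  by apply: combT; rewrite -subr_eq0 (_ : _ - _ = 1) ?oner_eq0 //; ring.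
have v'T : (p - 2%:R) *: u + (p - 1) *: v \in T.
  by apply: combT; rewrite -subr_eq0 (_ : _ - _ = -1) ?oppr_eq0 ?oner_eq0 //; ring.
have E : u + v = ((3%:R - p) *: u + (2%:R - p) *: v) + ((p - 2%:R) *: u + (p - 1) *: v).
  by apply/rowP => i; rewrite !mxE; ring.
have vu : B v u = 0 by rewrite alternating_antisym uv oppr0.
have Bu' : B ((3%:R - p) *: u + (2%:R - p) *: v) t = 2%:R by rewrite !bilE ut vt; ring.
have Bv' : B ((p - 2%:R) *: u + (p - 1) *: v) t = - 1 by rewrite !bilE ut vt; ring.
rewrite E; apply: (centre_add u'T v'T tT); rewrite -?E ?B1 ?Bu' ?Bv' ?oppr_eq0 ?oner_eq0 //.
by rewrite !bilE !altB uv vu; ring.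
Qed.

Lemma all_centres x : x != 0 -> x \in T.
Proof.
suff : (x == 0) || (x \in T) by case: eqP.
move: x (T_span x); apply: span_set_ind => [|a u y uT]; first by rewrite eqxx.
have [->|a0] := eqVneq a 0; first by rewrite scale0r add0r.
have auT : a *: u \in T by apply: T_scale.
case/orP=> [/eqP ->|yT]; first by rewrite addr0 auT orbT.
by have [//|uy] := eqVneq (a *: u + y) 0; rewrite centre_addr.
Qed.

End TransvectionCentres.

(** * Matrices given by their action *)

Section RankOneIsometries.

Local Open Scope ring_scope.

Variables (F : finFieldType) (n : nat) (B : {biscalar 'rV[F]_n.+1}).
Implicit Types (u v w x y z t : 'rV[F]_n.+1) (a : F) (g h : {'GL_n.+1[F]}).

(** The left inverse serves to see that the matrix of [f] has trivial kernel. *)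
Lemma GL_of_fun (f f' : 'rV[F]_n.+1 -> 'rV[F]_n.+1) :
    (forall a x y, f (a *: x + y) = a *: f x + f y) -> cancel f f' ->
  exists g, forall x, act x g = f x.
Proof.
move=> flin fK.
have fD x y : f (x + y) = f x + f y by rewrite -[x]scale1r flin !scale1r.
have f0 : f 0 = 0 by apply: (addIr (f 0)); rewrite -fD !add0r.
have fZ a x : f (a *: x) = a *: f x by rewrite -[a *: x]addr0 flin f0 addr0.
pose M : 'M[F]_n.+1 := \matrix_i f (delta_mx 0 i).
have ME x : x *m M = f x.
  rewrite [x in RHS]row_sum_delta mulmx_sum_row (big_morph f fD f0).
  by apply: eq_bigr => i _; rewrite fZ rowK.
have uM : M \is a GRing.unit.
  rewrite -[_ \is a GRing.unit]/(M \in unitmx) -row_free_unit -kermx_eq0.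
  apply/rowV0P => x /sub_kermxP; rewrite ME => fx.
  by rewrite -[x]fK fx -f0 fK.
by exists (Sub M uM) => x; rewrite /act -ME.
Qed.

Lemma act_inj g h : (forall x, act x g = act x h) -> g = h.
Proof.
move=> E; apply: val_inj; apply/row_matrixP => i.
by rewrite rowE [in RHS]rowE; exact: E.
Qed.

Lemma isom_groupP g :
  reflect (forall x y, B (act x g) (act y g) = B x y) (g \in isom_group B).
Proof. exact: Defs.isomP. Qed.

End RankOneIsometries.

(** * The symplectic case *)

Section Symplectic.

Local Open Scope ring_scope.

Variables (F : finFieldType) (n : nat) (B : {biscalar 'rV[F]_n.+1}).
Hypotheses (two : (2%:R : F) != 0) (altB : pairing_alternating B).
Hypothesis ndB : pairing_nondegenerate B.
Hypothesis F_prime : forall a : F, exists k : nat, a = k%:R.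

Implicit Types (u v w x y z t : 'rV[F]_n.+1) (a : F) (g h : {'GL_n.+1[F]}).

Definition acts_as_transvection a v g := forall x, act x g = x + (a * B x v) *: v.

Lemma transvection_isom a v g : acts_as_transvection a v g -> g \in isom_group B.
Proof.
move=> gE; apply/isom_groupP => x y; rewrite !gE !bilE altB.
by rewrite (alternating_antisym altB y v); ring.
Qed.

(** For an isometry [x |-> x + f x *: v] of an alternating form, invariance gives
    [f y * B x v = f x * B y v], so [f] is proportional to [B _ v]. *)
Lemma drop1_transvection g : g \in isom_group B -> drop_dim g = 1%N ->
  exists a v, [/\ a != 0, v != 0 & acts_as_transvection a v g].
Proof.
move=> /isom_groupP gB; rewrite drop_dimE; set N := GLval g - 1%:M => rN.
have gN x : act x g = x + x *m N by rewrite mulmxBr mulmx1 addrC subrK.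
have N0 : N != 0 by rewrite -mxrank_eq0 rN.
have /rowV0Pn[v vN v0] := N0.
have Nv : (N <= v)%MS by have [_ <-] := mxrank_leqif_sup vN; rewrite rN rank_rV v0.
have [f fE] : exists f : 'rV[F]_n.+1 -> F, forall x, x *m N = f x *: v.
  have H x : exists a, x *m N = a *: v.
    by apply/sub_rVP; apply: submx_trans Nv; exact: submxMl.
  by have [f] := fin_all_exists H; exists f.
have [x0 fx0] : exists x0, f x0 != 0.
  have /submxP[x0 vE] := vN; exists x0; apply: contraNneq v0 => fx0.
  by rewrite vE fE fx0 scale0r.
have key x y : f y * B x v = f x * B y v.
  have := gB x y; rewrite !gN !fE !bilE altB (alternating_antisym altB y v) => /eqP.
  rewrite -subr_eq0 => /eqP E; apply/eqP; rewrite -subr_eq0 -E; apply/eqP; ring.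
have Bx0 : B x0 v != 0.
  apply: contraNneq v0 => x0v; apply/eqP/ndB => x; rewrite (alternating_antisym altB x).
  have /eqP := key x x0; rewrite x0v mulr0 mulf_eq0 (negPf fx0) => /eqP ->.
  by rewrite oppr0.
exists (f x0 / B x0 v), v; split=> // [|x]; first by rewrite mulf_neq0 ?invr_eq0.
rewrite gN fE; congr (_ + _ *: _); apply: (mulIf Bx0).
by rewrite -key mulrAC divfK // mulrC [RHS]mulrC mulrC.
Qed.

Section Generation.

Variable H : {group {'GL_n.+1[F]}}.
Hypothesis H_transv : forall a v, exists2 g, g \in H & acts_as_transvection a v g.

Let moved g := [set x | act x g != x].

Lemma move_back_fixes g x f : g \in isom_group B -> f \notin moved g -> B f (act x g - x) = 0.
Proof.
move=> /isom_groupP gB; rewrite inE negbK => /eqP fg.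
by rewrite bilDr bilNr -{1}fg gB subrr.
Qed.

(** The transvection along [v = x g - x] that sends [x g] back to [x] fixes
    every fixed vector of [g], because these are orthogonal to [v]. *)
Lemma transvection_fixes_more g x : g \in isom_group B -> B (act x g) x != 0 ->
  exists h, [/\ h \in H, h \in isom_group B & (#|moved (g * h)%g| < #|moved g|)%N].
Proof.
move=> gB gx; have [h hH hE] := H_transv (B (act x g) x)^-1 (act x g - x).
exists h; split=> //; first exact: transvection_isom hE.
apply: proper_card; apply/properP; split.
  apply/subsetP => f; apply: contraLR => fg; have := fg.
  rewrite !inE !negbK actM => /eqP ->.
  by rewrite hE (move_back_fixes _ gB fg) mulr0 scale0r addr0.
exists x; rewrite !inE.
  by apply: contraNneq gx => ->; rewrite altB.
rewrite actM negbK hE !bilE altB add0r mulrN mulVf // scaleN1r opprB.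
by rewrite addrC subrK.
Qed.

(** Transvections generate the symplectic group, by induction on the number of
    displaced vectors.  [transvection_fixes_more] applies unless [B (x g) x = 0] for
    all [x]; in that case [g] is an involution, and a transvection along a vector of
    the image of [g - 1] displaces no further vector and leads back to the first
    case. *)
Lemma isom_group_transvections g : g \in isom_group B -> g \in H.
Proof.
move: {2}(#|_|) (leqnn #|moved g|) => k; elim: k g => [|k IHk] g gk gB.
  suff -> : g = 1%g by [].
  apply: act_inj => x; rewrite act1; apply/eqP; apply: contraT => gx.
  have : x \in moved g by rewrite inE.
  by move: gk; rewrite leqn0 cards_eq0 => /eqP ->; rewrite inE.
have [->|g1] := eqVneq g 1%g; first by [].
suff [h [hH hB lt]] : exists h,
    [/\ h \in H, h \in isom_group B & (#|moved (g * h)%g| < #|moved g|)%N].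
  apply: (GL_group_cancelr hH); apply: IHk; last exact: GL_groupM.
  by rewrite -ltnS; exact: leq_trans lt gk.
have [[x gx]|no] : (exists x, B (act x g) x != 0) \/ (forall x, B (act x g) x = 0).
- have [/existsP|] := boolP [exists x, B (act x g) x != 0]; first by left.
  by rewrite negb_exists => /forallP no; right=> x; have := no x; rewrite negbK => /eqP.
- exact: transvection_fixes_more gx.
(* g is an involution, hence acts as -1 on the image of g - 1. *)
have [x0 gx0] : exists x, act x g != x.
  apply/existsP; apply: contraR g1; rewrite negb_exists => /forallP g1.
  by apply/eqP/act_inj => x; rewrite act1; have := g1 x; rewrite negbK => /eqP.
have [v vE] : exists v, v = act x0 g - x0 by exists (act x0 g - x0).
have v0 : v != 0 by rewrite vE subr_eq0.
have gg x : act (act x g) g = x.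
  apply/eqP; rewrite -subr_eq0; apply/eqP/ndB => y0.
  rewrite -(actKV g y0); move: (act y0 _) => y.
  rewrite bilDl bilNl (isom_groupP _ _ gB); apply/eqP; rewrite subr_eq0; apply/eqP.
  have : B (act (x + y) g) (x + y) = 0 by [].
  rewrite /act mulmxDl -/(act x g) -/(act y g) !bilE !no (alternating_antisym altB x) => E.
  by apply/eqP; rewrite -subr_eq0 -E; apply/eqP; ring.
have gv : act v g = - v by rewrite vE {1}/act mulmxBl -/(act _ g) gg opprB.
have [h hH hE] := H_transv 1 v; have hB := transvection_isom hE.
have [x vx] : exists x, B v x != 0.
  apply/existsP; apply: contraR v0; rewrite negb_exists => /forallP vx.
  by apply/eqP/ndB => x; have := vx x; rewrite negbK => /eqP.
have ghx : B (act x (g * h)%g) x != 0.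
  rewrite actM hE !bilE no add0r mul1r -(isom_groupP _ _ gB (act x g) v) gg gv bilNr.
  by rewrite (alternating_antisym altB v) opprK mulf_neq0.
have [h' [h'H h'B lt]] := transvection_fixes_more (GL_groupM gB hB) ghx.
exists (h * h')%g; split; try exact: GL_groupM.
rewrite mulgA; apply: leq_trans lt _.
apply/subset_leq_card/subsetP => f; apply: contraLR => fg; have := fg.
rewrite !inE !negbK actM => /eqP ->.
by rewrite hE vE (move_back_fixes _ gB fg) mulr0 scale0r addr0.
Qed.

End Generation.

Variable G : {group {'GL_n.+1[F]}}.
Hypothesis G_isom : G \subset isom_group B.
Hypothesis G_irr : forall U : 'M[F]_n.+1,
  (forall g, g \in G -> (U *m GLval g <= U)%MS) -> U != 0 -> (1%:M <= U)%MS.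

(** Asking for the whole root group, and not for one transvection only, makes this
    set stable under scaling. *)
Definition centres : {set 'rV[F]_n.+1} :=
  [set v | (v != 0) && [forall a, exists g in G, forall x, act x g == x + (a * B x v) *: v]].

Lemma centresP v :
  reflect (v != 0 /\ forall a, exists2 g, g \in G & acts_as_transvection a v g)
          (v \in centres).
Proof.
rewrite inE; apply: (iffP andP) => -[v0 vG]; split=> //.
  move=> a; have /exists_inP[g gG /forallP gE] := forallP vG a.
  by exists g => // x; apply/eqP.
apply/forallP => a; have [g gG gE] := vG a; apply/exists_inP; exists g => //.
by apply/forallP => x; apply/eqP.
Qed.

(** Over a prime field the powers of one transvection fill its root group. *)
Lemma centre_of_transvection a v g :
  a != 0 -> v != 0 -> g \in G -> acts_as_transvection a v g -> v \in centres.
Proof.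
move=> a0 v0 gG gE; apply/centresP; split=> // b.
have [k bk] := F_prime (b / a); exists (g ^+ k)%g; rewrite ?GL_groupX // => x.
have -> : b = a * k%:R by rewrite -bk mulrC divfK.
elim: k {bk} => [|k IHk]; first by rewrite act1 mulr0 mul0r scale0r addr0.
rewrite act_expS IHk gE !bilE altB.
by apply/rowP => i; rewrite !mxE -natr1; ring.
Qed.

Lemma centres_act g v : g \in G -> v \in centres -> act v g \in centres.
Proof.
move=> gG /centresP[v0 vG]; have gB := subsetP G_isom _ gG.
apply/centresP; split=> [|a].
  apply: contraNneq v0 => /(congr1 (fun x => act x g^-1%g)).
  by rewrite actK /act mul0mx => ->.
have [h hG hE] := vG a; exists (g^-1 * h * g)%g => [|x]; first by rewrite !GL_groupM ?GL_groupV.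
rewrite !actM hE {1}/act mulmxDl -scalemxAl -!/(act _ g) actKV.
by rewrite -(isom_groupP _ _ gB (act x _)) actKV.
Qed.

Lemma centres_scale b v : b != 0 -> v \in centres -> b *: v \in centres.
Proof.
move=> b0 /centresP[v0 vG]; apply/centresP; split=> [|a].
  by rewrite scaler_eq0 negb_or b0.
have [g gG gE] := vG (a * b ^+ 2); exists g => // x.
by rewrite gE !bilE scalerA; congr (_ + _ *: _); ring.
Qed.

Lemma centres_step a u v :
  u \in centres -> v \in centres -> B u v != 0 -> u + a *: v \in centres.
Proof.
move=> uT /centresP[_ vG] uv; have [g gG gE] := vG (a / B u v).
by rewrite -[a](divfK uv) -gE centres_act.
Qed.

Variables (r : nat) (S S0 : {set {'GL_n.+1[F]}}).
Hypothesis S_gen : <<S>>%g = G.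
Hypothesis S_drop : forall g, g \in S -> (drop_dim g <= r)%N.
Hypothesis S_order : forall g, g \in S :\: S0 ->
  coprime #[g]%g (r.+1)`! \/ pseudoreflection g.
Hypothesis S0_sub : S0 \subset S.
Hypothesis S0_card : (2 * r.+1 * #|S0| <= n.+1)%N.

(** A centre and a neighbour of it are independent, so the graph of centres is
    connected; then every nonzero vector is a centre. *)
Theorem symplectic_full :
  (exists2 g, g \in G & transvection g) -> G = isom_group B :> {set _}.
Proof.
case=> g0 g0G /andP[/eqP g01 _].
have [a [v [a0 v0 gE]]] := drop1_transvection (subsetP G_isom _ g0G) g01.
have vT := centre_of_transvection a0 v0 g0G gE.
have orthoC u w : B u w = 0 -> B w u = 0.
  by rewrite (alternating_antisym altB u) => ->; rewrite oppr0.
have T_span x : (x <= span_set centres)%MS.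
  exact: (span_stable_full G_irr centres_act vT v0).
have T_n0 : 0 \notin centres by rewrite inE eqxx.
have [w vw wT] : exists2 w, B v w != 0 & w \in centres.
  have [w wT vw] := span_not_orthogonal ndB T_span v0.
  by exists w.
have T_conn u t : u \in centres -> t \in centres -> connect (linked B centres) u t.
  apply: (Phi_connected ndB orthoC G_isom G_irr centres_act T_span S_gen S_drop S_order
    S0_sub S0_card T_n0).
  exists v, w; split=> //; first by rewrite connect1 // /linked vT wT.
  by apply: contra vw => /sub_rVP[b ->]; rewrite bilZr altB mulr0.
have allT x : x != 0 -> x \in centres.
  exact: (all_centres two altB ndB centres_scale centres_step T_n0 T_conn T_span).
apply/eqP; rewrite eqEsubset G_isom /=; apply/subsetP => g gB.
apply: (isom_group_transvections _ gB) => b u.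
have [->|u0] := eqVneq u 0.
  by exists 1%g => // x; rewrite act1 scaler0 addr0.
by have /centresP[_] := allT u u0.
Qed.

End Symplectic.

(** * Binary quadratic forms over a prime field *)

Section BinaryForms.

Local Open Scope ring_scope.

Variable F : finFieldType.
Hypothesis two : (2%:R : F) != 0.
Hypothesis F_prime : forall a : F, exists k : nat, a = k%:R.
Implicit Types (a b c e y : F).

Lemma nonsquare_ratio a b :
    a != 0 -> b != 0 -> (forall d, a != d ^+ 2) -> (forall d, b != d ^+ 2) ->
  exists d, a = b * d ^+ 2.
Proof.
move=> a0 b0 nsa nsb; have [z _ cov] := nonsquare_rep two.
case: (cov a a0) => -[d dE]; first by have := nsa d; rewrite dE eqxx.
case: (cov b b0) => -[d' d'E]; first by have := nsb d'; rewrite d'E eqxx.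
exists (d / d'); rewrite dE d'E.
have z0 : z != 0 by apply: contraNneq b0 => z0; rewrite d'E z0 mul0r.
have d'0 : d' != 0 by apply: contraNneq b0 => d0; rewrite d'E d0 expr0n mulr0.
by field.
Qed.

Lemma square_dec a : {exists b, a = b ^+ 2} + {forall b, a != b ^+ 2}.
Proof.
case: (boolP [exists b, a == b ^+ 2]) => [/existsP H|H]; [left|right].
  by case: H => b /eqP; exists b.
by move: H; rewrite negb_exists => /forallP.
Qed.

(** If [y] is a square, the form is hyperbolic.  If not, the form represents 1, so
    it suffices that it represents a nonsquare.  Otherwise [-y] is a square, sums of
    two squares are squares, and then so is every element of the prime field. *)
Lemma binary_form_universal y e : y != 0 -> exists s t, s ^+ 2 - y * t ^+ 2 = e.
Proof.
move=> y0; have [[z zE]|nsy] := square_dec y.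
  have z0 : z != 0 by apply: contraNneq y0 => z0; rewrite zE z0 expr0n.
  by exists ((1 + e) / 2%:R), ((1 - e) / 2%:R / z); rewrite zE; field; rewrite z0.
have [[b ->]|nse] := square_dec e.
  by exists b, 0; ring.
have e0 : e != 0 by have := nse 0; rewrite expr0n.
have [[s t]|no] := pickP (fun st : F * F => [forall b, st.1 ^+ 2 - y * st.2 ^+ 2 != b ^+ 2]).
  rewrite /= => /forallP ns.
  have N0 : s ^+ 2 - y * t ^+ 2 != 0 by have := ns 0; rewrite expr0n.
  have [d ->] := nonsquare_ratio e0 N0 nse ns.
  by exists (s * d), (t * d); ring.
have sq s t : exists b, s ^+ 2 - y * t ^+ 2 = b ^+ 2.
  have := no (s, t); move/negbT; rewrite negb_forall => /existsP[b].
  by rewrite negbK /= => /eqP; exists b.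
have [d dE] := sq 0 1.
have sum s t : exists b, s ^+ 2 + t ^+ 2 = b ^+ 2.
  have d0 : d != 0.
    apply: contraNneq y0 => d0; move: dE.
    by rewrite d0 !expr0n expr1n mulr1 sub0r => /eqP; rewrite oppr_eq0.
  have [b bE] := sq s (t / d); exists b; rewrite -bE.
  have -> : y = - d ^+ 2 by rewrite -dE; ring.
  by field.
have [k kE] := F_prime y.
have [b bE] : exists b, y = b ^+ 2.
  rewrite kE; elim: k {kE} => [|k [b bE]]; first by exists 0; rewrite expr0n.
  by have [b' b'E] := sum b 1; exists b'; rewrite -b'E -bE -natr1 expr1n.
by have := nsy b; rewrite bE eqxx.
Qed.

End BinaryForms.

(** * Reflections and Siegel transformations *)

Section Siegel.

Local Open Scope ring_scope.

Variables (F : finFieldType) (n : nat) (B : {biscalar 'rV[F]_n.+1}).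
Hypotheses (two : (2%:R : F) != 0) (symB : pairing_symmetric B).
Implicit Types (u v w x y z : 'rV[F]_n.+1) (a b : F).

Definition refl v x : 'rV[F]_n.+1 := x - (2%:R * B x v / B v v) *: v.

(** The Siegel (or Eichler) transformation, for [w] singular and [u] orthogonal to
    [w]: the unipotent isometry that fixes [w] and moves the vectors orthogonal to [w]
    by multiples of [w]. *)
Definition siegel w u x : 'rV[F]_n.+1 :=
  x + B x w *: u - B x u *: w - (2%:R^-1 * B u u * B x w) *: w.

Lemma refl_isom v x y : B v v != 0 -> B (refl v x) (refl v y) = B x y.
Proof. by move=> v0; rewrite /refl !bilE (symB v y); field. Qed.

Lemma reflK v : B v v != 0 -> involutive (refl v).
Proof.
by move=> v0 x; rewrite /refl !bilE; apply/rowP => i; rewrite !mxE; field.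
Qed.

Lemma siegel_add w u v x : B w w = 0 -> B u w = 0 -> B v w = 0 ->
  siegel w u (siegel w v x) = siegel w (u + v) x.
Proof.
move=> ww uw vw; rewrite /siegel !bilE ww vw (symB w u) (symB v u) uw.
by apply/rowP => i; rewrite !mxE; field.
Qed.

Lemma siegel0 w x : siegel w 0 x = x.
Proof. by rewrite /siegel !bilE scaler0 mulr0 mul0r !scale0r !subr0 addr0. Qed.

Lemma siegel_shift w u a x : B w w = 0 -> B u w = 0 ->
  siegel w (u + a *: w) x = siegel w u x.
Proof.
move=> ww uw; rewrite /siegel !bilE ww uw (symB w u) uw.
by apply/rowP => i; rewrite !mxE; field.
Qed.

Lemma siegel_scale w u a x : siegel (a *: w) u x = siegel w (a *: u) x.
Proof. by rewrite /siegel !bilE; apply/rowP => i; rewrite !mxE; ring. Qed.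

Lemma siegel_conj v w u x : B v v != 0 ->
  siegel (refl v w) (refl v u) x = refl v (siegel w u (refl v x)).
Proof.
move=> v0; rewrite -{1}[x](reflK v0) /siegel !refl_isom //.
move: (refl v x) => {}x; rewrite /refl !bilE.
by apply/rowP => i; rewrite !mxE; field; apply/andP.
Qed.

(** How Siegel transformations arise from reflections: two roots that differ by an
    orthogonal singular vector. *)
Lemma refl_refl_siegel u w x : B u u != 0 -> B w w = 0 -> B u w = 0 ->
  refl (u + w) (refl u x) = siegel w (- (2%:R / B u u) *: u) x.
Proof.
move=> u0 ww uw.
have uwE : B (u + w) (u + w) = B u u by rewrite !bilE ww (symB w u) uw !addr0.
rewrite {1}/refl uwE /refl /siegel !bilE uw.
by apply/rowP => i; rewrite !mxE; field; apply/andP.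
Qed.

End Siegel.

(** * Transitivity on vectors of a given norm *)

Section Transitivity.

Local Open Scope ring_scope.

Variables (F : finFieldType) (n : nat) (B : {biscalar 'rV[F]_n.+1}).
Hypotheses (two : (2%:R : F) != 0) (symB : pairing_symmetric B).
Hypothesis F_prime : forall a : F, exists k : nat, a = k%:R.
Implicit Types (u v x y z : 'rV[F]_n.+1) (a b s t : F).

(* A is a set of vectors orthogonal to a hyperbolic pair (w, w'), and Theta is a
   set preserved by the Siegel transformations of w and of w' along A. *)
Variables (A : 'rV[F]_n.+1 -> Prop) (Theta : {set 'rV[F]_n.+1}).
Variables (a0 : 'rV[F]_n.+1).

Section HalfPair.

Variables w w' : 'rV[F]_n.+1.
Hypotheses (ww : B w w = 0) (ww' : B w w' = 1) (w'w' : B w' w' = 0).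
Hypothesis A_w : forall z, A z -> B z w = 0.
Hypothesis A_w' : forall z, A z -> B z w' = 0.
Hypothesis A_scale : forall a z, A z -> A (a *: z).
Hypothesis Theta_w : forall u x, A u -> x \in Theta -> siegel B w u x \in Theta.

Lemma siegel_memE u x : A u -> (siegel B w u x \in Theta) = (x \in Theta).
Proof.
move=> Au; apply/idP/idP; last exact: Theta_w.
have ANu : A (- u) by rewrite -scaleN1r; apply: A_scale.
move/(Theta_w ANu); by rewrite siegel_add // ?addNr ?siegel0 ?A_w.
Qed.

(** The Siegel transformation along [- b^-1 *: z] removes the component [z]. *)
Lemma clear_component a b z : A z -> b != 0 ->
  (a *: w + b *: w' + z \in Theta) = ((a + B z z / (2%:R * b)) *: w + b *: w' \in Theta).
Proof.
move=> Az b0; rewrite -(@siegel_memE (- b^-1 *: z)); last exact: A_scale.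
congr (in_mem _ _); rewrite /siegel !bilE (symB w z) (symB w' z) (symB w' w) ww ww' (A_w Az) (A_w' Az).
by apply/rowP => i; rewrite !mxE; field; apply/andP.
Qed.

Lemma shift_component a z : A z -> B z z != 0 ->
  (z \in Theta) = (a *: w + z \in Theta).
Proof.
move=> Az z0; rewrite -(@siegel_memE (- (a / B z z) *: z)); last exact: A_scale.
congr (in_mem _ _); rewrite /siegel !bilE (A_w Az).
by apply/rowP => i; rewrite !mxE; field; apply/andP.
Qed.

End HalfPair.

Variables w w' : 'rV[F]_n.+1.
Hypotheses (ww : B w w = 0) (ww' : B w w' = 1) (w'w' : B w' w' = 0).
Hypothesis A_w : forall z, A z -> B z w = 0.
Hypothesis A_w' : forall z, A z -> B z w' = 0.
Hypothesis A_scale : forall a z, A z -> A (a *: z).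
Hypothesis Theta_w : forall u x, A u -> x \in Theta -> siegel B w u x \in Theta.
Hypothesis Theta_w' : forall u x, A u -> x \in Theta -> siegel B w' u x \in Theta.

Lemma clear_component_w a b z : A z -> b != 0 ->
  (a *: w + b *: w' + z \in Theta) = ((a + B z z / (2%:R * b)) *: w + b *: w' \in Theta).
Proof. exact: clear_component. Qed.

Lemma clear_component_w' a b z : A z -> a != 0 ->
  (a *: w + b *: w' + z \in Theta) = (a *: w + (b + B z z / (2%:R * a)) *: w' \in Theta).
Proof.
move=> Az a_n0; rewrite -!(addrC (_ *: w')).
by rewrite (clear_component w'w' _ A_w' A_w) // symB.
Qed.

Lemma norm_decomposed a b z : A z -> 
  B (a *: w + b *: w' + z) (a *: w + b *: w' + z) = 2%:R * a * b + B z z.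
Proof.
move=> Az; rewrite !bilE (symB w z) (symB w' z) (symB w' w) ww ww' w'w' (A_w Az) (A_w' Az).
by ring.
Qed.

Lemma move_to_plane a b z : A z ->
    B (a *: w + b *: w' + z) (a *: w + b *: w' + z) != 0 ->
  exists a' b', 2%:R * a' * b' = B (a *: w + b *: w' + z) (a *: w + b *: w' + z) /\
    (a *: w + b *: w' + z \in Theta) = (a' *: w + b' *: w' \in Theta).
Proof.
move=> Az; rewrite norm_decomposed // => N0.
have [b_0|b_n0] := eqVneq b 0; last first.
  exists (a + B z z / (2%:R * b)), b; rewrite clear_component_w //; split=> //.
  by field; rewrite b_n0.
suff [a' [a'0 ->]] : exists a', a' != 0 /\
    (a *: w + b *: w' + z \in Theta) = (a' *: w + b *: w' + z \in Theta).
  exists a', (b + B z z / (2%:R * a')); rewrite clear_component_w' //; split=> //.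
  by rewrite b_0; field; rewrite a'0.
have [a_0|a_n0] := eqVneq a 0; last by exists a.
exists 1; rewrite oner_eq0; split=> //.
rewrite b_0 a_0 !scale0r !add0r addr0; apply: shift_component => //.
by move: N0; rewrite b_0 mulr0 add0r.
Qed.

Hypothesis A_a0 : A a0.
Hypothesis a0_norm : B a0 a0 != 0.

Lemma plane_root a b s : s != 0 -> 2%:R * a * b = B a0 a0 * s ^+ 2 ->
  (a *: w + b *: w' \in Theta) = (s *: a0 \in Theta).
Proof.
move=> s0 ab; have a_n0 : a != 0.
  apply: contraNneq (mulf_neq0 a0_norm (expf_neq0 2 s0)) => a_0.
  by rewrite -ab a_0 mulr0 mul0r.
have As : A (s *: a0) by apply: A_scale.
have N : B (s *: a0) (s *: a0) = 2%:R * a * b by rewrite ab !bilE; ring.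
have N0 : B (s *: a0) (s *: a0) != 0 by rewrite N ab mulf_neq0 ?expf_neq0.
rewrite (shift_component ww A_w A_scale Theta_w a As N0).
have := clear_component_w' 0 As a_n0; rewrite N scale0r addr0 add0r => ->.
by congr (in_mem (_ + _ *: _) _); field; rewrite ?a_n0 ?b_n0 ?two.
Qed.

(** The vector with an extra component [s *: a0] is carried to the hyperbolic plane
    by the transformations of [w] and by those of [w']; the two results differ by a
    diagonal change. *)
Lemma plane_rotate a b s : a != 0 -> b != 0 ->
  let e := 1 - B a0 a0 / (2%:R * a * b) * s ^+ 2 in e != 0 ->
  (a *: w + b *: w' \in Theta) = ((a * e) *: w + (b / e) *: w' \in Theta).
Proof.
move=> a_n0 b_n0 e e0; have As : A (s *: a0) by apply: A_scale.
have N : B (s *: a0) (s *: a0) = B a0 a0 * s ^+ 2 by rewrite !bilE; ring.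
have qE : B a0 a0 * s ^+ 2 = (1 - e) * (2%:R * a * b) by rewrite /e; field; rewrite ?a_n0 ?b_n0 ?two.
transitivity ((a * e) *: w + b *: w' + s *: a0 \in Theta).
  rewrite clear_component_w // N qE; congr (in_mem (_ *: _ + _) _).
  by field; rewrite ?a_n0 ?b_n0 ?two.
rewrite clear_component_w' ?mulf_neq0 // N qE; congr (in_mem (_ + _ *: _) _).
by field; rewrite ?a_n0 ?b_n0 ?two ?e0.
Qed.

(** If the norm is that of a multiple [s *: a0], both vectors are conjugate to it.
    Otherwise the norm of [a0] divided by the common norm is a nonsquare [k], so all
    factors [1 - k * s ^+ 2] are available in [plane_rotate], and every ratio is a
    quotient of two of them because [s ^+ 2 - y * t ^+ 2] is universal. *)
Lemma plane_transitive a b a' b' :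
    2%:R * a * b != 0 -> 2%:R * a * b = 2%:R * a' * b' ->
  (a *: w + b *: w' \in Theta) = (a' *: w + b' *: w' \in Theta).
Proof.
move=> N0 E; have [[s sE]|ns] := square_dec (2%:R * a * b / B a0 a0).
  have sq : 2%:R * a * b = B a0 a0 * s ^+ 2 by rewrite -sE mulrCA divff ?mulr1.
  have s0 : s != 0 by apply: contraNneq N0 => s0; rewrite sq s0 expr0n mulr0.
  by rewrite (plane_root s0 sq) (plane_root (a := a') (b := b') s0) // -E.
have : [&& a != 0, b != 0, a' != 0 & b' != 0].
  have : 2%:R * a' * b' != 0 by rewrite -E.
  by move: N0; rewrite !mulf_eq0 !negb_or (negPf two) /= => /andP[-> ->] /andP[-> ->].
case/and4P=> a_n0 b_n0 a'_n0 b'_n0; pose k := B a0 a0 / (2%:R * a * b).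
have k0 : k != 0 by rewrite mulf_neq0 ?invr_eq0.
have nk s : 1 - k * s ^+ 2 != 0.
  apply/eqP => /eqP; rewrite subr_eq0 => /eqP E1.
  have := ns s; rewrite (_ : _ / _ = k^-1); last first.
    by rewrite /k; field; rewrite ?a_n0 ?b_n0 ?two ?a0_norm.
  by case/eqP; apply: (mulfI k0); rewrite divff // E1.
have [s [t st]] : exists s t, 1 - k * s ^+ 2 = a' / a * (1 - k * t ^+ 2).
  have [s [t st]] := binary_form_universal two F_prime ((1 - a' / a) / k)
     (mulf_neq0 a'_n0 (invr_neq0 a_n0)).
  exists s, t; have -> : s ^+ 2 = a' / a * t ^+ 2 + (1 - a' / a) / k by rewrite -st; ring.
  by field; rewrite ?k0 ?a_n0.
pose e := 1 - k * s ^+ 2; pose e' := 1 - k * t ^+ 2.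
have kE : k = B a0 a0 / (2%:R * a' * b') by rewrite /k E.
have e'0 : 1 - B a0 a0 / (2%:R * a' * b') * t ^+ 2 != 0 by rewrite -kE nk.
rewrite (plane_rotate (a := a) (b := b) (s := s)) ?nk // -/k -/e.
rewrite (plane_rotate (a := a') (b := b') (s := t)) // -kE -/e'.
have e'_n0 : e' != 0 by exact: nk.
have bE : b = a' / a * b' by apply: (mulfI (mulf_neq0 two a_n0)); rewrite E; field; rewrite ?a_n0 ?two.
rewrite /e st -/e' bE; congr (in_mem (_ *: _ + _ *: _) _); field => //.
by rewrite a_n0 a'_n0 e'_n0.
Qed.

Lemma norm_transitive a b z a' b' z' :
    let x := a *: w + b *: w' + z in let x' := a' *: w + b' *: w' + z' in
    A z -> A z' -> B x x = B x' x' -> B x x != 0 ->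
  (x \in Theta) = (x' \in Theta).
Proof.
move=> x x' Az Az' xx' x0; have x'0 : B x' x' != 0 by rewrite -xx'.
have [c [d [cd ->]]] := move_to_plane Az x0.
have [c' [d' [cd' ->]]] := move_to_plane Az' x'0.
by apply: plane_transitive; rewrite cd // cd'.
Qed.

End Transitivity.

(** * Sets of roots closed under reflection *)

Section RootSets.

Local Open Scope ring_scope.

Variables (F : finFieldType) (n : nat) (B : {biscalar 'rV[F]_n.+1}).
Hypotheses (two : (2%:R : F) != 0) (three : (3%:R : F) != 0).
Hypothesis symB : pairing_symmetric B.
Hypothesis F_prime : forall a : F, exists k : nat, a = k%:R.
Implicit Types (u v w x y z : 'rV[F]_n.+1) (a b s t : F).

Variables (Phi : {set 'rV[F]_n.+1}) (c : F).
Hypothesis c0 : c != 0.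
Hypothesis Phi_norm : forall v, v \in Phi -> B v v = c.
Hypothesis Phi_refl : forall u v, u \in Phi -> v \in Phi -> refl B u v \in Phi.

Definition refl_closed (Theta : {set 'rV[F]_n.+1}) :=
  forall v x, v \in Phi -> x \in Theta -> refl B v x \in Theta.

(** A consequence of [siegel B w u] being a product of reflections along [Phi], stated
    on the sets that these reflections preserve: this suffices to compare orbits of
    vectors, and it can be transported and added without introducing a group. *)
Definition siegel_stable w u :=
  forall Theta, refl_closed Theta -> forall x, x \in Theta -> siegel B w u x \in Theta.

Lemma root_norm_n0 v : v \in Phi -> B v v != 0.
Proof. by move/Phi_norm ->. Qed.

Lemma siegel_stable_Phi w u x : siegel_stable w u -> x \in Phi -> siegel B w u x \in Phi.
Proof. by apply => v y; apply: Phi_refl. Qed.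

Lemma siegel_stableD w u v : B w w = 0 -> B u w = 0 -> B v w = 0 ->
  siegel_stable w u -> siegel_stable w v -> siegel_stable w (u + v).
Proof.
move=> ww uw vw stu stv Theta Tcl x xT.
by rewrite -(siegel_add two symB) //; apply: stu => //; apply: stv.
Qed.

(** The field is prime, so scaling is repeated addition. *)
Lemma siegel_stableZ w u a : B w w = 0 -> B u w = 0 ->
  siegel_stable w u -> siegel_stable w (a *: u).
Proof.
move=> ww uw stu; have [k ->] := F_prime a; elim: k => [|k IHk].
  by rewrite scale0r => Theta _ x; rewrite siegel0.
rewrite -natr1 scalerDl scale1r; apply: siegel_stableD => //.
by rewrite bilE uw mulr0.
Qed.

Lemma siegel_stableZ_inv w u a : B w w = 0 -> B u w = 0 -> a != 0 ->
  siegel_stable w (a *: u) -> siegel_stable w u.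
Proof.
move=> ww uw a0 st; rewrite -[u](scalerK a0); apply: siegel_stableZ => //.
by rewrite bilE uw mulr0.
Qed.

Lemma siegel_stable_conj v w u : v \in Phi ->
  siegel_stable w u -> siegel_stable (refl B v w) (refl B v u).
Proof.
move=> vP st Theta Tcl x xT; rewrite siegel_conj ?root_norm_n0 //.
by apply: (Tcl) => //; apply: st => //; apply: (Tcl).
Qed.

Lemma siegel_stable_roots w u a b : B w w = 0 -> B u w = 0 -> a != b ->
  u + a *: w \in Phi -> u + b *: w \in Phi -> siegel_stable w u.
Proof.
move=> ww uw ab uaP ubP; have [v vE] : exists v, v = u + a *: w by exists (u + a *: w).
have [d dE] : exists d, d = b - a by exists (b - a).
have d0 : d != 0 by rewrite dE subr_eq0 eq_sym.
have vw : B v w = 0 by rewrite vE !bilE uw ww mulr0 addr0.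
have ubE : u + b *: w = v + d *: w by rewrite vE dE -addrA -scalerDl [a + _]addrC subrK.
have v0 : B v v != 0 by rewrite root_norm_n0 // vE.
have std : siegel_stable (d *: w) (- (2%:R / B v v) *: v).
  move=> Theta Tcl x xT; rewrite -refl_refl_siegel ?bilE ?vw ?ww ?mulr0 //.
  by rewrite -ubE; apply: (Tcl) => //; apply: (Tcl); rewrite // vE.
have stw : siegel_stable w v.
  apply: (siegel_stableZ_inv (a := d * - (2%:R / B v v))) => //.
    by rewrite mulf_neq0 // oppr_eq0 mulf_neq0 // invr_eq0.
  by rewrite -scalerA => Theta Tcl x; rewrite -siegel_scale; apply: std.
by move=> Theta Tcl x; rewrite -(siegel_shift two symB a) // -vE; apply: stw.
Qed.

Section ThreeSpace.

Variables w w' a0 : 'rV[F]_n.+1.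
Hypotheses (ww : B w w = 0) (ww' : B w w' = 1) (w'w' : B w' w' = 0).
Hypotheses (a0w : B a0 w = 0) (a0w' : B a0 w' = 0) (a0P : a0 \in Phi).
Hypotheses (stw : siegel_stable w a0) (stw' : siegel_stable w' a0).

Let a0a0 : B a0 a0 = c. Proof. exact: Phi_norm. Qed.

Let line z := exists a, z = a *: a0.

(* The first step of the growth: on the nondegenerate 3-space spanned by w, w' and
   the root a0, the Siegel transformations act transitively on each norm, also when
   a vector y orthogonal to the 3-space is added throughout. *)
Lemma three_norm a b s :
  B (a *: w + b *: w' + s *: a0) (a *: w + b *: w' + s *: a0) = 2%:R * a * b + s ^+ 2 * c.
Proof.
rewrite !bilE (symB w a0) (symB w' a0) (symB w' w) ww ww' w'w' a0w a0w' a0a0.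
ring.
Qed.

Let line_w z : line z -> B z w = 0. Proof. by case=> d ->; rewrite bilE a0w mulr0. Qed.
Let line_w' z : line z -> B z w' = 0. Proof. by case=> d ->; rewrite bilE a0w' mulr0. Qed.
Let line_scale d z : line z -> line (d *: z).
Proof. by case=> e ->; exists (d * e); rewrite scalerA. Qed.
Let line_a0 : line a0. Proof. by exists 1; rewrite scale1r. Qed.
Let line_scale_a0 d : line (d *: a0). Proof. by exists d. Qed.

Lemma siegel_tail w1 y u x : siegel_stable w1 a0 -> B w1 w1 = 0 -> B a0 w1 = 0 ->
    B y w1 = 0 -> B y a0 = 0 -> line u ->
  x \in [set z | z + y \in Phi] -> siegel B w1 u x \in [set z | z + y \in Phi].
Proof.
move=> st1 w1w1 a0w1 yw1 ya0 [d ->]; rewrite !inE => xT.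
have -> : siegel B w1 (d *: a0) x + y = siegel B w1 (d *: a0) (x + y).
  by rewrite /siegel !bilE yw1 ya0; apply/rowP => i; rewrite !mxE; ring.
by apply: siegel_stable_Phi => //; apply: siegel_stableZ.
Qed.

Section Tail.

Variable y : 'rV[F]_n.+1.
Hypotheses (yw : B y w = 0) (yw' : B y w' = 0) (ya0 : B y a0 = 0).

Let tail_w u x := @siegel_tail w y u x stw ww a0w yw ya0.
Let tail_w' u x := @siegel_tail w' y u x stw' w'w' a0w' yw' ya0.

Lemma three_transitive a b s a' b' s' :
    2%:R * a * b + s ^+ 2 * c = 2%:R * a' * b' + s' ^+ 2 * c ->
    2%:R * a * b + s ^+ 2 * c != 0 ->
  a *: w + b *: w' + s *: a0 + y \in Phi -> a' *: w + b' *: w' + s' *: a0 + y \in Phi.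
Proof.
move=> E N0 xP.
have := norm_transitive two symB F_prime ww ww' w'w' line_w line_w' line_scale tail_w tail_w'
  line_a0 (root_norm_n0 a0P) (a := a) (b := b) (a' := a') (b' := b')
  (line_scale_a0 s) (line_scale_a0 s').
by rewrite !three_norm => /(_ E N0); rewrite !inE xP.
Qed.

Lemma clear_singular a b s : b != 0 -> 2%:R * a * b + s ^+ 2 * c = 0 ->
  a *: w + b *: w' + s *: a0 + y \in Phi -> b *: w' + y \in Phi.
Proof.
move=> b0 N0 xP.
have := clear_component_w two symB ww ww' line_w line_w' line_scale tail_w a
  (line_scale_a0 s) b0.
rewrite (_ : a + _ = 0) ?scale0r ?add0r ?inE ?xP //.
by rewrite !bilE a0a0 -(mul0r (2%:R * b)^-1) -N0; field; apply/andP.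
Qed.

End Tail.

Lemma three_full a b s : 2%:R * a * b + s ^+ 2 * c = c -> a *: w + b *: w' + s *: a0 \in Phi.
Proof.
move=> E; rewrite -[_ + _ *: a0]addr0.
apply: (@three_transitive 0 _ _ _ 0 0 1); rewrite ?bilE // ?E.
- by rewrite expr1n; ring.
- by rewrite mulr0 add0r expr1n mul1r.
- by rewrite !scale0r scale1r !add0r addr0.
Qed.

(** Reflect in the root [w + (c / 2) w']. *)
Lemma singular_to_w y d : B y w = 0 -> B y w' = 0 ->
  d *: w' + y \in Phi -> (- (2%:R * d / c)) *: w + y \in Phi.
Proof.
move=> yw yw' dP; pose h := 1 *: w + (c / 2%:R) *: w' + 0 *: a0.
have hP : h \in Phi by apply: three_full; field.
suff -> : - (2%:R * d / c) *: w + y = refl B h (d *: w' + y) by exact: Phi_refl.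
rewrite /refl (Phi_norm hP) /h !bilE (symB w' w) (symB w' a0) a0w' yw yw' w'w' ww' mul0r.
by apply/rowP => i; rewrite !mxE; field; apply/andP.
Qed.

(** The product of the reflections in [w + (c / 2) w'] and [2 w + (c / 4) w']
    multiplies [w] by 4. *)
Lemma singular_times4 y d : B y w = 0 -> B y w' = 0 ->
  d *: w + y \in Phi -> (4%:R * d) *: w + y \in Phi.
Proof.
move=> yw yw' dP; pose h1 := 1 *: w + (c / 2%:R) *: w' + 0 *: a0.
pose h2 := 2%:R *: w + (c / 4%:R) *: w' + 0 *: a0.
have four : (4%:R : F) != 0 by rewrite (natrM F 2 2) mulf_neq0.
have h1P : h1 \in Phi by apply: three_full; field.
have h2P : h2 \in Phi by apply: three_full; field.
suff -> : (4%:R * d) *: w + y = refl B h2 (refl B h1 (d *: w + y)).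
  by apply: Phi_refl => //; apply: Phi_refl.
rewrite /refl (Phi_norm h1P) (Phi_norm h2P) /h1 /h2 !bilE.
rewrite (symB w' w) (symB w' a0) (symB w a0) a0w a0w' yw yw' w'w' ww' ww a0a0 !mul0r !mulr0.
by apply/rowP => i; rewrite !mxE; field; rewrite ?c0 ?two ?four.
Qed.

(** If the part of the root in the 3-space is singular, it can be moved to [d *: w];
    then [y + d *: w] and [y + 4 d *: w] are roots, and they are distinct since the
    characteristic is not 3. *)
Lemma stable_singular y a b s : B y w = 0 -> B y w' = 0 -> B y a0 = 0 ->
    2%:R * a * b + s ^+ 2 * c = 0 -> (a != 0) || (b != 0) ->
  a *: w + b *: w' + s *: a0 + y \in Phi -> siegel_stable w y.
Proof.
move=> yw yw' ya0 N0 ab xP.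
have [d d0 dP] : exists2 d, d != 0 & d *: w + y \in Phi.
  have [b0|b_n0] := eqVneq b 0; last first.
    exists (- (2%:R * b / c)); first by rewrite oppr_eq0 !mulf_neq0 ?invr_eq0.
    by apply: singular_to_w => //; exact: clear_singular xP.
  have s0 : s = 0.
    by apply/eqP; move/eqP: N0; rewrite b0 mulr0 add0r mulf_eq0 (negPf c0) orbF sqrf_eq0.
  exists a; first by move: ab; rewrite b0 eqxx orbF.
  by move: xP; rewrite b0 s0 !scale0r !addr0.
apply: (siegel_stable_roots (a := d) (b := 4%:R * d)) => //.
- rewrite -subr_eq0 (_ : _ - _ = - (3%:R * d)); last by ring.
  by rewrite oppr_eq0 mulf_neq0.
- by rewrite addrC.
- by rewrite addrC singular_times4.
Qed.

(** The rational parametrisation of the conic [s ^+ 2 * c + t ^+ 2 * k = c] from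
    its point [(-1, 0)], at slope 1, or at slope 2 when [k = - c].  The last
    condition only has to be checked when [s = 0]: then [k = c], or else [k = - c]
    and the characteristic is 5. *)
Lemma conic_point k : exists s t,
  [/\ s ^+ 2 * c + t ^+ 2 * k = c, t != 0 & (s != 0) || (c - 2%:R * k != 0)].
Proof.
have [ck|ck] := eqVneq (c + k) 0.
  have -> : k = - c by apply/eqP; rewrite -addr_eq0 addrC ck.
  exists (- (5%:R / 3%:R)), (- (4%:R / 3%:R)); split.
  - by field.
  - by rewrite oppr_eq0 mulf_neq0 ?invr_eq0 // (natrM F 2 2) mulf_neq0.
  - by rewrite (_ : _ - _ = 3%:R * c) ?mulf_neq0 ?orbT //; ring.
exists ((c - k) / (c + k)), (2%:R * c / (c + k)); split.
- by field.
- by rewrite !mulf_neq0 ?invr_eq0.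
have [->|ckn] := eqVneq k c.
  by rewrite (_ : _ - _ * _ = - c) ?oppr_eq0 ?c0 ?orbT //; ring.
by rewrite mulf_neq0 ?invr_eq0 // subr_eq0 eq_sym.
Qed.

(** The main step.  Let the root be [x + y] with [x] nonzero in the 3-space and [y]
    orthogonal to it.  When [x] is singular, use [stable_singular].  Otherwise choose
    a vector [s1 *: a0 + t *: y] of norm [c] with [t] nonzero.  For every nonzero [mu]
    the vector [s1 *: a0 + t *: y + mu *: w] turns out to be a root, and two such
    roots give the Siegel transformation of [w] along [s1 *: a0 + t *: y], hence
    along [y]. *)
Lemma root_tail_stable y a b s : B y w = 0 -> B y w' = 0 -> B y a0 = 0 ->
    [|| a != 0, b != 0 | s != 0] ->
  a *: w + b *: w' + s *: a0 + y \in Phi -> siegel_stable w y.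
Proof.
move=> yw yw' ya0 nz xP.
have [m mE] : exists m, m = 2%:R * a * b + s ^+ 2 * c by eexists.
have [m0|m0] := eqVneq m 0.
  rewrite mE in m0; apply: (stable_singular yw yw' ya0 m0) xP.
  move: nz; have [a_0|//] := eqVneq a 0; have [b_0|//] := eqVneq b 0; rewrite /=.
  move/eqP: m0; rewrite a_0 b_0 mulr0 add0r mulf_eq0 (negPf c0) orbF sqrf_eq0.
  by move=> ->.
have [k kE] : exists k, k = B y y by eexists.
have mk : m = c - k.
  have := Phi_norm xP; rewrite !bilE.
  rewrite (symB w y) (symB w' y) (symB a0 y) (symB w a0) (symB w' a0) (symB w' w).
  rewrite yw yw' ya0 ww ww' w'w' a0w a0w' a0a0 => E.
  by rewrite mE kE -[c in RHS]E; ring.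
have [s1 [t [st t0 s1k]]] := conic_point k.
have key mu : mu != 0 -> s1 *: a0 + t *: y + mu *: w \in Phi.
  (* Find a conjugate x' of x for which the reflection in x' + y removes exactly
     t *: y: this is the linear condition B x' (s1 *: a0 + mu *: w) = e.  The
     reflected vector lies in the 3-space and has norm c, so it is a root. *)
  move=> mu0; have [e eE] : exists e, e = t * (c - 2%:R * k) / 2%:R by eexists.
  have [g [d [d0 gd]]] : exists g d, d != 0 /\ s1 * g * c + mu * d = e.
    have [s10|s1_n0] := eqVneq s1 0.
      exists 0, (e / mu); rewrite mulr0 mul0r add0r mulrCA divff // mulr1; split=> //.
      by move: s1k; rewrite s10 eqxx eE /= => ck; rewrite !mulf_neq0 ?invr_eq0.
    exists ((e - mu) / (s1 * c)), 1; rewrite oner_eq0; split=> //.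
    by field; rewrite ?s1_n0 ?c0.
  have muE : mu = (e - s1 * g * c) / d by rewrite -gd; field.
  have [h hE] : exists h, h = (m - g ^+ 2 * c) / (2%:R * d) by eexists.
  have vP : h *: w + d *: w' + g *: a0 + y \in Phi.
    have hm : m = 2%:R * h * d + g ^+ 2 * c by rewrite hE; field; apply/andP.
    by apply: three_transitive xP; rewrite // -mE.
  have zP : (mu - t * h) *: w + (- (t * d)) *: w' + (s1 - t * g) *: a0 \in Phi.
    apply: three_full; rewrite -[RHS]st muE hE eE mk; field; apply/andP; split=> //.
  have zv : B ((mu - t * h) *: w + (- (t * d)) *: w' + (s1 - t * g) *: a0)
              (h *: w + d *: w' + g *: a0 + y) = - (t * c / 2%:R).
    rewrite !bilE (symB w y) (symB w' y) (symB a0 y) (symB w a0) (symB w' a0) (symB w' w).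
    rewrite yw yw' ya0 ww ww' w'w' a0w a0w' a0a0 muE hE eE mk; field; apply/andP; split=> //.
  suff -> : s1 *: a0 + t *: y + mu *: w =
      refl B (h *: w + d *: w' + g *: a0 + y)
             ((mu - t * h) *: w + (- (t * d)) *: w' + (s1 - t * g) *: a0).
    exact: Phi_refl.
  rewrite /refl (Phi_norm vP) zv.
  by apply/rowP => i; rewrite !mxE; field; apply/andP.
have uw : B (s1 *: a0 + t *: y) w = 0 by rewrite !bilE a0w yw; ring.
apply: (siegel_stableZ_inv (a := t)) => //.
have -> : t *: y = (s1 *: a0 + t *: y) + (- s1) *: a0.
  by rewrite scaleNr addrAC subrr add0r.
apply: siegel_stableD => //; first by rewrite bilE a0w mulr0.
  apply: (siegel_stable_roots (a := 1) (b := 2%:R)); rewrite ?key ?oner_eq0 //.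
  by rewrite eq_sym -subr_eq0 (_ : _ - _ = 1) ?oner_eq0 //; ring.
exact: siegel_stableZ.
Qed.

End ThreeSpace.

Hypothesis Phi_span : forall x, (x <= span_set Phi)%MS.
Hypothesis Phi_conn : forall u v, u \in Phi -> v \in Phi -> connect (linked B Phi) u v.

(** The Siegel transformation of [w] along [v0] is a product of two reflections.  The
    reflection in a root [v] not orthogonal to [w] carries [w] to a vector [w1] with
    [B w w1 != 0], and fixes a translate [a0] of [v0] by a multiple of [w]. *)
Lemma hyperbolic_pair v0 w : v0 \in Phi -> v0 + w \in Phi -> w != 0 -> B w w = 0 ->
    (exists2 v, v \in Phi & B w v != 0) ->
  exists w' (a0 : 'rV[F]_n.+1), [/\ B w w' = 1, B w' w' = 0, a0 \in Phi, B a0 w = 0 & B a0 w' = 0] /\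
    siegel_stable w a0 /\ siegel_stable w' a0.
Proof.
move=> v0P v0wP w0 ww [v vP wv].
have v0w : B v0 w = 0.
  have := Phi_norm v0wP; rewrite !bilE ww (Phi_norm v0P) (symB w v0) => E.
  apply: (mulfI two); rewrite mulr0; apply: (addrI c); rewrite -{2}[c]addr0 -[in RHS]E; ring.
have stv0 : siegel_stable w v0.
  apply: (siegel_stable_roots (a := 0) (b := 1)); rewrite ?scale0r ?scale1r ?addr0 //.
  by rewrite eq_sym oner_eq0.
have [w1 w1E] : exists w1, w1 = refl B v w by eexists.
have ww1 : B w w1 = - (2%:R * B w v ^+ 2 / c).
  rewrite w1E /refl (Phi_norm vP) !bilE ww; ring.
have ww1_0 : B w w1 != 0 by rewrite ww1 oppr_eq0 !mulf_neq0 ?invr_eq0.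
have w1w1 : B w1 w1 = 0 by rewrite w1E refl_isom ?root_norm_n0.
have [d dE] : exists d, d = (B w w1)^-1 by eexists.
have d0 : d != 0 by rewrite dE invr_eq0.
have [a0 a0E] : exists a0 : 'rV[F]_n.+1, a0 = v0 + (- (B v0 w1 * d)) *: w by eexists.
have a0w : B a0 w = 0 by rewrite a0E !bilE v0w ww; ring.
have a0w1 : B a0 w1 = 0 by rewrite a0E !bilE dE; field.
have sta0 : siegel_stable w a0.
  by move=> Theta Tcl x xT; rewrite a0E siegel_shift //; apply: stv0.
have a0P : a0 \in Phi.
  have [e eE] : exists e, e = B v0 w1 * d / c by eexists.
  have -> : a0 = siegel B w (e *: v0) v0.
    rewrite /siegel !bilE v0w (Phi_norm v0P) a0E eE.
    by apply/rowP => i; rewrite !mxE; field; apply/andP.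
  by apply: siegel_stable_Phi => //; apply: siegel_stableZ.
have a0v : B a0 v = 0.
  have := a0w1; rewrite w1E /refl (Phi_norm vP) !bilE a0w add0r => /eqP.
  by rewrite oppr_eq0 !mulf_eq0 (negPf two) (negPf wv) invr_eq0 (negPf c0) /= => /eqP.
have sta0' : siegel_stable w1 a0.
  have -> : a0 = refl B v a0 by rewrite /refl a0v mulr0 mul0r scale0r subr0.
  by rewrite w1E; apply: siegel_stable_conj.
exists (d *: w1), a0; rewrite !bilE w1w1 a0w1 dE mulVf // !mulr0; split=> //; split=> //.
by move=> Theta Tcl x xT; rewrite siegel_scale; apply: siegel_stableZ.
Qed.

Section Spread.

Variables w w' a0 : 'rV[F]_n.+1.
Hypotheses (ww : B w w = 0) (ww' : B w w' = 1) (w'w' : B w' w' = 0).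
Hypotheses (a0w : B a0 w = 0) (a0w' : B a0 w' = 0) (a0P : a0 \in Phi).
Hypotheses (stw : siegel_stable w a0) (stw' : siegel_stable w' a0).

(* The vectors along which both families of Siegel transformations are available;
   they will be all vectors orthogonal to w and w'. *)
Let A z := [/\ B z w = 0, B z w' = 0, siegel_stable w z & siegel_stable w' z].

Let A_w z : A z -> B z w = 0. Proof. by case. Qed.
Let A_w' z : A z -> B z w' = 0. Proof. by case. Qed.

Let AD z1 z2 : A z1 -> A z2 -> A (z1 + z2).
Proof.
move=> [z1w z1w' st1 st1'] [z2w z2w' st2 st2']; split.
- by rewrite bilE z1w z2w addr0.
- by rewrite bilE z1w' z2w' addr0.
- exact: siegel_stableD.
- exact: siegel_stableD.
Qed.

Let AZ a z : A z -> A (a *: z).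
Proof.
move=> [zw zw' st st']; split; try exact: siegel_stableZ.
- by rewrite bilE zw mulr0.
- by rewrite bilE zw' mulr0.
Qed.

Let A_a0 : A a0. Proof. by []. Qed.

Let pr x := x - B x w' *: w - B x w *: w'.

Lemma tail_in_A v : v \in Phi -> [|| B v w' != 0, B v w != 0 | B v a0 != 0] -> A (pr v).
Proof.
move=> vP nz; have [s sE] : exists s, s = B v a0 / c by eexists.
have [y yE] : exists y, y = pr v - s *: a0 by eexists.
have w'w : B w' w = 1 by rewrite symB.
have yw : B y w = 0 by rewrite yE /pr !bilE ww w'w a0w; ring.
have yw' : B y w' = 0 by rewrite yE /pr !bilE w'w' ww' a0w'; ring.
have ya0 : B y a0 = 0.
  rewrite yE /pr !bilE (symB w a0) (symB w' a0) a0w a0w' (Phi_norm a0P) sE; field.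
  exact: c0.
have vE : v = B v w' *: w + B v w *: w' + s *: a0 + y.
  by rewrite yE /pr; apply/rowP => i; rewrite !mxE; ring.
have nz' : [|| B v w' != 0, B v w != 0 | s != 0].
  by rewrite sE mulf_eq0 invr_eq0 (negPf c0) orbF.
have -> : pr v = s *: a0 + y by rewrite yE addrC subrK.
apply: AD; first exact: AZ.
have vP1 := vP; rewrite vE in vP1.
split=> //; first by move: vP1; apply: root_tail_stable.
move: vP1; rewrite (addrC (_ *: w)); apply: root_tail_stable => //.
by rewrite orbCA.
Qed.

(** Connectedness: walk from [a0] along linked roots.  If the next root [u] has no
    component in the 3-space, then moving it by the Siegel transformation of [w]
    along the component of the current root creates one without changing its
    projection. *)
Lemma root_pr v : v \in Phi -> A (pr v).
Proof.
move=> vP; have /connectP[p] := Phi_conn a0P vP.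
have : A (pr a0) by rewrite /pr a0w a0w' !scale0r !subr0.
elim: p (a0) => [|u p IHp] t At /= => [_ -> //|/andP[/and3P[tP uP tu]]].
apply: IHp; have [|] := boolP [|| B u w' != 0, B u w != 0 | B u a0 != 0].
  exact: tail_in_A.
rewrite !negb_or !negbK => /and3P[/eqP uw' /eqP uw /eqP ua0].
have [e eE] : exists e, e = B (pr t) u by eexists.
have e0 : e != 0.
  rewrite eE /pr !bilE (symB w u) (symB w' u) uw uw'.
  by rewrite !mulr0 !oppr0 !addr0.
have u'P : u + (- e) *: w \in Phi.
  case: At => _ _ st _; have := siegel_stable_Phi st uP.
  rewrite /siegel uw scale0r addr0 mulr0 scale0r subr0 (symB u) -eE.
  by rewrite scaleNr.
have := tail_in_A u'P; have -> : pr (u + (- e) *: w) = pr u.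
  rewrite /pr !bilE uw uw' ww ww'; apply/rowP => i; rewrite !mxE; ring.
by apply; rewrite !bilE uw' ww' add0r mulr1 oppr_eq0 e0.
Qed.

Lemma all_pr x : A (pr x).
Proof.
move: x (Phi_span x); apply: span_set_ind => [|a u x uP Ax].
  by have -> : pr 0 = 0 *: a0; [rewrite /pr !bilE !scale0r !subr0 | exact: AZ].
have -> : pr (a *: u + x) = a *: pr u + pr x.
  by rewrite /pr !bilE; apply/rowP => i; rewrite !mxE; ring.
by apply: AD => //; apply: AZ; apply: root_pr.
Qed.

Lemma spread_transitive Theta x y : refl_closed Theta ->
  B x x = B y y -> B x x != 0 -> (x \in Theta) = (y \in Theta).
Proof.
move=> Tcl E N0; have xE z : z = B z w' *: w + B z w *: w' + pr z.
  by rewrite /pr; apply/rowP => i; rewrite !mxE; ring.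
have Tw u z : A u -> z \in Theta -> siegel B w u z \in Theta by case=> _ _ st _; apply: st.
have Tw' u z : A u -> z \in Theta -> siegel B w' u z \in Theta by case=> _ _ _ st; apply: st.
have := norm_transitive two symB F_prime ww ww' w'w' A_w A_w' AZ Tw Tw' A_a0 (root_norm_n0 a0P)
  (a := B x w') (b := B x w) (a' := B y w') (b' := B y w) (all_pr x) (all_pr y).
by rewrite -!xE; apply.
Qed.

End Spread.

(** Connectedness makes the Siegel transformations of a hyperbolic pair available along
    all directions orthogonal to it, so that [norm_transitive] applies to all vectors. *)
Theorem root_set_transitive v0 w Theta x y :
    v0 \in Phi -> v0 + w \in Phi -> w != 0 -> B w w = 0 ->
    (exists2 v, v \in Phi & B w v != 0) ->
  refl_closed Theta -> B x x = B y y -> B x x != 0 -> (x \in Theta) = (y \in Theta).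
Proof.
move=> v0P v0wP w0 ww wv Tcl E N0.
have [w' [a0 [[ww' w'w' a0P a0w a0w'] [st st']]]] := hyperbolic_pair v0P v0wP w0 ww wv.
exact: (spread_transitive ww ww' w'w' a0w a0w' a0P st st').
Qed.

End RootSets.

(** * Reflections generate the orthogonal group *)

Section Reflections.

Local Open Scope ring_scope.

Variables (F : finFieldType) (n : nat) (B : {biscalar 'rV[F]_n.+1}).
Hypotheses (two : (2%:R : F) != 0) (symB : pairing_symmetric B).
Hypothesis ndB : pairing_nondegenerate B.
Implicit Types (u v w x y z f : 'rV[F]_n.+1) (a b s t : F) (g h : {'GL_n.+1[F]}).

Definition acts_as_refl v g := forall x, act x g = refl B v x.

Lemma reflection_exists v : B v v != 0 -> exists g, acts_as_refl v g.
Proof.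
move=> v0; apply: (GL_of_fun (f' := refl B v)); last exact: reflK.
by move=> a x y; rewrite /refl !bilE; apply/rowP => i; rewrite !mxE; ring.
Qed.

Lemma acts_as_refl_isom v g : B v v != 0 -> acts_as_refl v g -> g \in isom_group B.
Proof. by move=> v0 gE; apply/isom_groupP => x y; rewrite !gE refl_isom. Qed.

Lemma acts_as_refl_inj v g h : acts_as_refl v g -> acts_as_refl v h -> g = h.
Proof. by move=> gE hE; apply: act_inj => x; rewrite gE hE. Qed.

Lemma acts_as_refl_mulgg v g : B v v != 0 -> acts_as_refl v g -> (g * g = 1)%g.
Proof. by move=> v0 gE; apply: act_inj => x; rewrite actM act1 !gE reflK. Qed.

Lemma acts_as_reflJ v g h : h \in isom_group B ->
  acts_as_refl v g -> acts_as_refl (act v h) (g ^ h)%g.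
Proof.
move=> hB gE x; rewrite /conjg !actM gE -[in RHS](actKV h x).
move: (act x _) => {}x; rewrite /refl !(isom_groupP _ _ hB).
by rewrite {1}/act mulmxBl -scalemxAl.
Qed.

Lemma reflZ a v x : a != 0 -> refl B (a *: v) x = refl B v x.
Proof.
move=> a0; rewrite /refl !bilE scalerA; congr (_ - _ *: _).
have [->|v0] := eqVneq (B v v) 0; first by rewrite !mulr0 invr0 !mulr0 mul0r.
by field; rewrite v0.
Qed.

Lemma refl_orth v x : B x v = 0 -> refl B v x = x.
Proof. by move=> xv; rewrite /refl xv mulr0 mul0r scale0r subr0. Qed.

(** Two factorisations of the same block matrix. *)
Lemma det_rank1_update (c : 'cV[F]_n.+1) v :
  \det (1%:M + c *m v) = 1 + (v *m c) 0 0.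
Proof.
pose L := block_mx 1%:M 0 v 1%:M : 'M[F]_(n.+1 + 1).
have E1 : block_mx 1%:M (- c) v 1%:M = L *m block_mx 1%:M (- c) 0 (1%:M + v *m c).
  rewrite mulmx_block ?mul1mx ?mul0mx ?mulmx1 ?mulmx0 !addr0 mulmxN.
  by rewrite addrCA addNr addr0.
have E2 : block_mx 1%:M (- c) v 1%:M = block_mx (1%:M + c *m v) (- c) 0 1%:M *m L.
  rewrite mulmx_block ?mul1mx ?mul0mx ?mulmx1 ?mulmx0 !add0r mulNmx.
  by rewrite addrK.
have := congr1 determinant E1; rewrite E2 !det_mulmx !det_ublock !det_lblock !det1 !mul1r !mulr1.
by move=> ->; rewrite det_mx11 !mxE eqxx.
Qed.

Lemma acts_as_reflE v g : acts_as_refl v g ->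
  GLval g = 1%:M + (\col_i (- (2%:R * B (delta_mx 0 i) v / B v v))) *m v.
Proof.
move=> gE; apply/row_matrixP => i; rewrite rowE -[LHS]/(act (delta_mx 0 i) g) gE.
rewrite linearD /= row1 row_mul /refl -scaleNr; congr (_ + _).
by apply/rowP => j; rewrite !mxE big_ord1 !mxE.
Qed.

Lemma acts_as_refl_reflection v g : B v v != 0 -> acts_as_refl v g ->
  reflection g && (eigenspace (GLval g) (-1) == v)%MS.
Proof.
move=> v0 gE; have v_n0 : v != 0 by apply: contraNneq v0 => ->; rewrite bil0l.
have gv : act v g = - v.
  by rewrite gE /refl; apply/rowP => i; rewrite !mxE; field.
apply/andP; split; first (apply/andP; split).
- rewrite /pseudoreflection drop_dimE (acts_as_reflE gE) addrC addKr eqn_leq.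
  apply/andP; split; first by apply: leq_trans (mxrankM_maxr _ _) (rank_leq_row _).
  rewrite lt0n mxrank_eq0; apply: contraNneq v_n0 => E.
  have := acts_as_reflE gE; rewrite E addr0 => g1; move: gv; rewrite /act g1 mulmx1 => /eqP.
  by rewrite -subr_eq0 opprK -mulr2n -scaler_nat scaler_eq0 (negPf two).
- rewrite (acts_as_reflE gE) det_rank1_update; apply/eqP.
  set e := (_ *m _) 0 0; suff -> : e = - 2%:R by ring.
  transitivity (- (2%:R * B v v / B v v)); last by field.
  have -> : 2%:R * B v v = \sum_i 2%:R * (v 0 i * B (delta_mx 0 i) v).
    rewrite -mulr_sumr {1}[v]row_sum_delta linear_sumlz; congr (_ * _).
    by apply: eq_bigr => i _; rewrite bilZl.
  by rewrite mulr_suml -sumrN /e mxE; apply: eq_bigr => i _; rewrite !mxE; ring.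
apply/andP; split; last by apply/eigenspaceP; rewrite -/(act v g) gv scaleN1r.
apply/row_subP => i; move: (row i _) (row_sub i (eigenspace (GLval g) (-1))) => x.
move/eigenspaceP; rewrite -/(act x g) gE scaleN1r => xg.
apply/sub_rVP; exists (B x v / B v v); apply/eqP; rewrite -subr_eq0.
have /eqP : 2%:R *: (x - (B x v / B v v) *: v) = 0.
  rewrite -(subrr x) -{4}[x]opprK -xg /refl.
  by apply/rowP => i'; rewrite !mxE; ring.
by rewrite scaler_eq0 (negPf two).
Qed.

Section Generation.

Variable H : {group {'GL_n.+1[F]}}.
Hypothesis H_refl : forall v, B v v != 0 -> exists2 g, g \in H & acts_as_refl v g.

(** Of [x g - x] and [x g + x] at least one is nonsingular, because their norms add
    up to 4 times that of [x]; reflect in the first, or else in the second and then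
    in [x]. *)
Lemma reflect_back g x : g \in isom_group B -> B x x != 0 ->
  exists h, [/\ h \in H, h \in isom_group B, act (act x g) h = x &
    forall f, act f g = f -> B f x = 0 -> act f h = f].
Proof.
move=> gB x0; have gI := isom_groupP _ _ gB.
have fgx f : act f g = f -> B f x = 0 -> B f (act x g) = 0.
  by move=> fg fx; rewrite -fg gI.
have [E|N0] := eqVneq (B (act x g - x) (act x g - x)) 0; last first.
  have [h hH hE] := H_refl N0; exists h; split=> //.
  - exact: acts_as_refl_isom hE.
  - rewrite hE /refl; move: N0; rewrite !bilE gI (symB x (act x g)) => N0.
    apply/rowP => i; rewrite !mxE; field.
    by apply: contraNneq N0 => E; apply/eqP; rewrite -[RHS]E; ring.
  - by move=> f fg fx; rewrite hE refl_orth // !bilE fgx // fx subr0.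
have xgx : B (act x g) x = B x x.
  move: E; rewrite !bilE gI (symB x (act x g)) => E.
  by apply: (mulfI two); apply/eqP; rewrite eq_sym -subr_eq0 -E; apply/eqP; ring.
have N0 : B (act x g + x) (act x g + x) != 0.
  rewrite !bilE gI (symB x (act x g)) xgx (_ : _ + _ = 2%:R * 2%:R * B x x); last by ring.
  by rewrite !mulf_neq0.
have [h hH hE] := H_refl N0; have [h' h'H h'E] := H_refl x0; exists (h * h')%g; split.
- exact: GL_groupM.
- by apply: GL_groupM; [apply: acts_as_refl_isom hE | apply: acts_as_refl_isom h'E].
- rewrite actM hE h'E /refl !bilE gI (symB x (act x g)) xgx.
  apply/rowP => i; rewrite !mxE; field; rewrite x0 /=.
  rewrite (_ : _ + _ = 2%:R * 2%:R * B x x); last by ring.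
  by rewrite !mulf_neq0.
- by move=> f fg fx; rewrite actM hE h'E !refl_orth // !bilE ?fgx // fx addr0.
Qed.

(** Reflections generate the orthogonal group.  The induction keeps a subspace [P]
    that has an orthogonal supplement fixed by [g], and replaces it by its
    intersection with the orthogonal of a nonsingular [x] in [P]. *)
Lemma Cartan_Dieudonne g : g \in isom_group B -> g \in H.
Proof.
move=> gB; suff gen (P : {set 'rV[F]_n.+1}) :
    (forall a x y, x \in P -> y \in P -> a *: x + y \in P) ->
    (forall y, exists p f, [/\ y = p + f, p \in P, act f g = f &
       forall z, z \in P -> B f z = 0]) -> g \in H.
  apply: (gen setT) => [a x y|y]; rewrite ?inE //.
  exists y, 0; rewrite addr0 inE /act mul0mx; split=> // z _; exact: bil0l.
move: {2}(#|_|) (leqnn #|P|) => k; elim: k g P gB => [|k IHk] g P gB Pk Plin Pdec.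
  have [p [f [_ pP _ _]]] := Pdec 0.
  by move: Pk; rewrite leqn0 cards_eq0 => /eqP P0; rewrite P0 inE in pP.
have [/existsP[z /andP[zP z0]]|] := boolP [exists z, (z \in P) && (z != 0)]; last first.
  rewrite negb_exists => /forallP P0; suff -> : g = 1%g by [].
  apply: act_inj => y; rewrite act1; have [p [f [-> pP fg _]]] := Pdec y.
  have := P0 p; rewrite pP negbK => /eqP ->.
  by rewrite add0r.
have [x xP x0] : exists2 x, x \in P & B x x != 0.
  have [y zy] : exists y, B z y != 0.
    apply/existsP; apply: contraR z0; rewrite negb_exists => /forallP zy.
    by apply/eqP/ndB => y; have := zy y; rewrite negbK => /eqP.
  have [p [f [yE pP _ fP]]] := Pdec y.
  have zp : B z p != 0 by move: zy; rewrite yE bilDr (symB z f) fP ?addr0.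
  have [zz|] := eqVneq (B z z) 0; last by exists z.
  have [pp|] := eqVneq (B p p) 0; last by exists p.
  exists (1 *: z + p); first exact: Plin.
  rewrite scale1r !bilE zz pp (symB p z) (_ : _ + _ = 2%:R * B z p); last by ring.
  by rewrite mulf_neq0.
have [h [hH hB hx hf]] := reflect_back gB x0.
apply: (GL_group_cancelr hH); apply: (IHk _ [set y in P | B y x == 0]).
- exact: GL_groupM.
- rewrite -ltnS; apply: leq_trans Pk; apply: proper_card; apply/properP; split.
    by apply/subsetP => y; rewrite inE => /andP[].
  by exists x; rewrite // inE xP.
- move=> a y y'; rewrite !inE => /andP[yP /eqP yx] /andP[y'P /eqP y'x].
  by rewrite Plin //= !bilE yx y'x mulr0 addr0.
move=> y; have [p [f [-> pP fg fP]]] := Pdec y.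
exists (- (B p x / B x x) *: x + p), (f + (B p x / B x x) *: x); split.
- by apply/rowP => i; rewrite !mxE; ring.
- by rewrite inE Plin //= !bilE; apply/eqP; field.
- by rewrite actM /act !mulmxDl -!scalemxAl -!/(act _ _) fg hx hf // fP.
- by move=> t; rewrite inE => /andP[tP /eqP tx]; rewrite !bilE fP // (symB x t) tx mulr0 addr0.
Qed.

End Generation.
End Reflections.

(** * Groups containing all reflections of one norm *)

Section OneNorm.

Local Open Scope ring_scope.

Variables (F : finFieldType) (n : nat) (B : {biscalar 'rV[F]_n.+1}).
Hypotheses (two : (2%:R : F) != 0) (symB : pairing_symmetric B).
Hypothesis ndB : pairing_nondegenerate B.
Implicit Types (u v w x y : 'rV[F]_n.+1) (a b d : F) (g h k : {'GL_n.+1[F]}).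

Variables (c z : F).
Hypothesis c0 : c != 0.
Hypothesis z_classes :
  forall a, a != 0 -> (exists b, a = b ^+ 2) \/ (exists b, a = z * b ^+ 2).

(* The group generated by the reflections of norm c is transitive on each nonzero
   norm; this is phrased with the sets that these reflections preserve. *)
Hypothesis norm_orbits : forall Theta : {set 'rV[F]_n.+1},
  (forall v x, B v v = c -> x \in Theta -> refl B v x \in Theta) ->
  forall x y, B x x = B y y -> B x x != 0 -> (x \in Theta) = (y \in Theta).

Definition norm_reflections (d : F) : {set {'GL_n.+1[F]}} :=
  [set g | [exists v, (B v v == d) && [forall x, act x g == refl B v x]]].

Lemma norm_reflectionsP (d : F) g :
  reflect (exists2 v, B v v = d & acts_as_refl B v g) (g \in norm_reflections d).
Proof.
rewrite inE; apply: (iffP existsP) => [[v /andP[/eqP vd /forallP gE]]|[v vd gE]].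
  by exists v => // x; apply/eqP.
by exists v; rewrite vd eqxx; apply/forallP => x; apply/eqP.
Qed.

Let N : {group {'GL_n.+1[F]}} := <<norm_reflections c>>%G.

Lemma norm_reflections_isom (d : F) : d != 0 -> norm_reflections d \subset isom_group B.
Proof.
move=> d0; apply/subsetP => g /norm_reflectionsP[v vd gE].
by apply: (acts_as_refl_isom symB _ gE); rewrite vd.
Qed.

Lemma isom_normalises_N g h : h \in isom_group B -> g \in N -> (g ^ h)%g \in N.
Proof.
move=> hB; apply: gen_conj_closed => k /norm_reflectionsP[v vc kE].
apply/norm_reflectionsP; exists (act v h); last exact: acts_as_reflJ.
by rewrite (isom_groupP _ _ hB).
Qed.

Lemma nonsingular_rescale v : B v v != 0 ->
  exists a u, [/\ a != 0, v = a *: u & B u u = c \/ B u u = z * c].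
Proof.
move=> v0; have vc0 : B v v / c != 0 by rewrite mulf_neq0 ?invr_eq0.
have resc b d : B v v / c = d * b ^+ 2 -> 
    exists a u, [/\ a != 0, v = a *: u & B u u = d * c].
  move=> E; have b0 : b != 0 by apply: contraNneq vc0 => b0; rewrite E b0 expr0n mulr0.
  exists b, (b^-1 *: v); rewrite scalerKV //; split=> //.
  rewrite !bilE; have -> : B v v = d * b ^+ 2 * c by rewrite -E divfK.
  by field.
case: (z_classes vc0) => -[b E].
  have [|a [u [a0 vE uc]]] := resc b 1; first by rewrite mul1r.
  by exists a, u; split=> //; left; rewrite uc mul1r.
by have [a [u [a0 vE uc]]] := resc b z E; exists a, u; split=> //; right.
Qed.

Lemma isom_subset_of_reflections (H : {group {'GL_n.+1[F]}}) :
  norm_reflections c \subset H -> norm_reflections (z * c) \subset H ->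
  isom_group B \subset H.
Proof.
move=> cH zcH; apply/subsetP => g; apply: (Cartan_Dieudonne two symB ndB) => v v0.
have [g' gE] := reflection_exists v0; exists g' => //.
have [a [u [a0 vE uE]]] := nonsingular_rescale v0.
have gE' : acts_as_refl B u g' by move=> x; rewrite gE vE reflZ.
case: uE => uE; [apply: (subsetP cH) | apply: (subsetP zcH)].
  by apply/norm_reflectionsP; exists u.
by apply/norm_reflectionsP; exists u.
Qed.

(** All reflections of norm [z * c] are conjugate under [N], by transitivity, and
    [N] is normal; so each of them lies in the coset of [s], and the isometry group,
    which is generated by reflections, is [N] together with that coset. *)
Lemma N_index2 s g : z != 0 -> s \in norm_reflections (z * c) -> g \in isom_group B ->
  (g \in N) || ((g * s)%g \in N).
Proof.
move=> z0 sR; have zc0 : z * c != 0 by rewrite mulf_neq0.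
have sB := subsetP (norm_reflections_isom zc0) _ sR.
have [v vzc sE] := norm_reflectionsP _ _ sR.
have ss : (s * s = 1)%g by apply: (acts_as_refl_mulgg _ sE); rewrite vzc.
have gM := involution_cosets_group_set (isom_group B) ss (fun k => isom_normalises_N sB (g := k)).
move=> gB; suff : g \in Group gM by case/setIdP.
have : isom_group B \subset Group gM; last by move/subsetP/(_ _ gB).
apply: isom_subset_of_reflections; apply/subsetP => h hR; apply/setIdP.
  by rewrite (subsetP (norm_reflections_isom c0) _ hR) (mem_gen hR).
rewrite (subsetP (norm_reflections_isom zc0) _ hR); split=> //.
have [u uzc hE] := norm_reflectionsP _ _ hR.
pose Theta := [set act v k | k in N].
have Tcl t x : B t t = c -> x \in Theta -> refl B t x \in Theta.
  move=> tc /imsetP[k kN ->]; have t0 : B t t != 0 by rewrite tc.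
  have [k' k'E] := reflection_exists t0.
  apply/imsetP; exists (k * k')%g; last by rewrite actM k'E.
  by apply: GL_groupM => //; apply: mem_gen; apply/norm_reflectionsP; exists t.
have : u \in Theta.
  rewrite (norm_orbits Tcl (y := v)) ?uzc ?vzc //.
  by apply/imsetP; exists 1%g; rewrite ?act1.
case/imsetP=> k kN uE; have kB : k \in isom_group B.
  by apply: subsetP kN; rewrite gen_subG norm_reflections_isom.
have hk : h = (s ^ k)%g.
  by apply: (acts_as_refl_inj hE); rewrite uE; apply: acts_as_reflJ.
by rewrite hk (involution_conj_coset ss (fun j => isom_normalises_N sB (g := j)) kN) orbT.
Qed.

(** [N] has index at most 2 in the isometry group. *)
Lemma isom_or_unique (K1 K2 : {group {'GL_n.+1[F]}}) : z != 0 ->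
    norm_reflections c \subset K1 -> K1 \subset isom_group B ->
    norm_reflections c \subset K2 -> K2 \subset isom_group B ->
    (forall g, g \in norm_reflections (z * c) -> g \notin K2) ->
  K1 = isom_group B :> {set _} \/ K1 = K2 :> {set _}.
Proof.
move=> z0 cK1 K1B cK2 K2B K2z.
have NK1 : N \subset K1 by rewrite gen_subG.
have NK2 : N \subset K2 by rewrite gen_subG.
have [/set0Pn[s sR]|] := boolP (norm_reflections (z * c) != set0); last first.
  rewrite negbK => /eqP no; left; apply/eqP; rewrite eqEsubset K1B /=.
  by apply: isom_subset_of_reflections; rewrite ?no ?sub0set.
have cosets g : g \in isom_group B -> (g \in N) || ((g * s)%g \in N) by exact: N_index2.
have := eq_of_two_cosets K1B NK1 cosets; case: ifP => _ K1E; first by left.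
by right; rewrite K1E (eq_of_two_cosets K2B NK2 cosets) (negPf (K2z s sR)).
Qed.

End OneNorm.

(** * The orthogonal case *)

Section Orthogonal.

Local Open Scope ring_scope.

Variables (F : finFieldType) (n : nat) (B : {biscalar 'rV[F]_n.+1}).
Hypotheses (two : (2%:R : F) != 0) (three : (3%:R : F) != 0).
Hypothesis symB : pairing_symmetric B.
Hypothesis ndB : pairing_nondegenerate B.
Hypothesis F_prime : forall a : F, exists k : nat, a = k%:R.
Implicit Types (u v w x y : 'rV[F]_n.+1) (a b d : F) (g h k : {'GL_n.+1[F]}).

Let spinP := spinor_normP two symB ndB.

Lemma spinor_sign g : g \in isom_group B -> spinor_norm B g = 1 \/ spinor_norm B g = -1.
Proof.
case/and3P: spinP => /forall_inP H _ _ /H /orP[]/eqP; by [left | right].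
Qed.

Lemma spinorM g h : g \in isom_group B -> h \in isom_group B ->
  spinor_norm B (g * h)%g = spinor_norm B g * spinor_norm B h.
Proof.
by case/and3P: spinP => _ /forall_inP H _ /H /forall_inP H' /H' /eqP.
Qed.

Lemma spinor_refl v g : B v v != 0 -> acts_as_refl B v g -> 
  spinor_norm B g = sq_class (B v v) /\ \det (GLval g) = -1.
Proof.
move=> v0 gE; have gB := acts_as_refl_isom symB v0 gE.
have gr := acts_as_refl_reflection two v0 gE.
split; last by case/andP: gr => /andP[_ /eqP].
case/and3P: spinP => _ _ /forall_inP /(_ g gB) /forallP /(_ v).
by rewrite gr => /eqP.
Qed.

Lemma spinor1 : spinor_norm B 1%g = 1.
Proof.
have := spinorM (group1 (isom_group B)) (group1 (isom_group B)); rewrite mulg1.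
have [->|->] := spinor_sign (group1 (isom_group B)); first by [].
by rewrite mulrNN mul1r.
Qed.

Lemma ker_spinor_group_set : group_set (ker_spinor B).
Proof.
apply/group_setP; split=> [|g h].
  by apply/setIdP; rewrite (group1 (isom_group B)) spinor1 eqxx.
case/setIdP=> gB /eqP gs /setIdP[hB /eqP hs]; apply/setIdP.
by rewrite (GL_groupM gB hB) spinorM // gs hs mulr1 eqxx.
Qed.

Lemma ker_spinor_det_group_set : group_set (ker_spinor_det B).
Proof.
apply/group_setP; split=> [|g h].
  by apply/setIdP; rewrite (group1 (isom_group B)) spinor1 GL_1E det1 mulr1 eqxx.
case/setIdP=> gB /eqP gs /setIdP[hB /eqP hs]; apply/setIdP.
by rewrite (GL_groupM gB hB) spinorM // GL_MxE det_mulmx mulrACA gs hs mulr1 eqxx.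
Qed.

Variable G : {group {'GL_n.+1[F]}}.
Hypothesis G_isom : G \subset isom_group B.
Hypothesis G_irr : forall U : 'M[F]_n.+1,
  (forall g, g \in G -> (U *m GLval g <= U)%MS) -> U != 0 -> (1%:M <= U)%MS.
Variables (r : nat) (S S0 : {set {'GL_n.+1[F]}}).
Hypothesis S_gen : <<S>>%g = G.
Hypothesis S_drop : forall g, g \in S -> (drop_dim g <= r)%N.
Hypothesis S_order : forall g, g \in S :\: S0 ->
  coprime #[g]%g (r.+1)`! \/ pseudoreflection g.
Hypothesis S0_sub : S0 \subset S.
Hypothesis S0_card : (2 * r.+1 * #|S0| <= n.+1)%N.

Definition roots (c : F) : {set 'rV[F]_n.+1} :=
  [set v | (B v v == c) && [exists g in G, forall x, act x g == refl B v x]].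

Lemma rootsP c v :
  reflect (B v v = c /\ exists2 g, g \in G & acts_as_refl B v g) (v \in roots c).
Proof.
rewrite inE; apply: (iffP andP) => [[/eqP vc /exists_inP[g gG /forallP gE]]|[vc [g gG gE]]].
  by split=> //; exists g => // x; apply/eqP.
by rewrite vc; split=> //; apply/exists_inP; exists g => //; apply/forallP => x; apply/eqP.
Qed.

Lemma roots_act c g v : g \in G -> v \in roots c -> act v g \in roots c.
Proof.
move=> gG /rootsP[vc [h hG hE]]; have gB := subsetP G_isom _ gG.
apply/rootsP; split; first by rewrite (isom_groupP _ _ gB).
by exists (h ^ g)%g; [rewrite groupJ | apply: acts_as_reflJ].
Qed.

(** The image of [g - 1] is fixed by [g], hence orthogonal to all [x g - x]. *)
Lemma shear_image_singular g x y : g \in isom_group B -> isotropic_shear g ->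
  B (act x g - x) (act y g - y) = 0.
Proof.
move=> gB /andP[_ /eqP g2]; have gI := isom_groupP _ _ gB.
have gg : (GLval g - 1%:M) *m (GLval g - 1%:M) = 0 by move: g2; rewrite expr2.
have fixg t : act (act t g - t) g = act t g - t.
  have tE : act t g - t = t *m (GLval g - 1%:M) by rewrite mulmxBr mulmx1.
  apply/eqP; rewrite -subr_eq0 tE /act -{2}[t *m _]mulmx1 -mulmxBr -mulmxA.
  by rewrite gg mulmx0.
by rewrite bilDl bilNl -{1}(fixg y) gI subrr.
Qed.

(** The shear moves some root [v] of norm [c], and [w = v g - v] is singular and
    orthogonal to [v].  This makes [v] and [v g] two independent linked roots, as
    needed for connectedness, and starts the growth of [root_set_transitive].  So
    [G] contains all reflections of norm [c].  One of the two spinor kernels also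
    contains them, and none of the other reflections: the spinor norm, or its
    product with the determinant, takes at each reflection the class of its norm
    times the class of [c]. *)
Theorem orthogonal_or_spinor :
    (exists2 g, g \in G & reflection g) -> (exists2 g, g \in G & isotropic_shear g) ->
  [\/ G = isom_group B :> {set _}, G = ker_spinor B :> {set _} |
      G = ker_spinor_det B :> {set _}].
Proof.
case=> g0 g0G /andP[g0r _] [sg sgG sgS]; have sgB := subsetP G_isom _ sgG.
have [v1 [v1_0 g0E]] := pseudoreflection_isomE two symB ndB (subsetP G_isom _ g0G) g0r.
pose c := B v1 v1; pose Phi := roots c.
have c0 : c != 0 by [].
have v1P : v1 \in Phi by apply/rootsP; split=> //; exists g0.
have Phi_norm v : v \in Phi -> B v v = c by case/rootsP.
have PhiG g v : g \in G -> v \in Phi -> act v g \in Phi by exact: roots_act.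
have Phi_refl u v : u \in Phi -> v \in Phi -> refl B u v \in Phi.
  by move=> /rootsP[_ [g gG gE]] vP; rewrite -gE PhiG.
have Phi_n0 : 0 \notin Phi by apply/negP => /Phi_norm/eqP; rewrite bil0l eq_sym (negPf c0).
have v1_n0 : v1 != 0 by apply: contraNneq Phi_n0 => <-.
have Phi_span x : (x <= span_set Phi)%MS.
  exact: (span_stable_full G_irr PhiG v1P v1_n0).
have [v vP vs] : exists2 v, v \in Phi & act v sg != v.
  apply/exists_inP; apply: contraT; rewrite negb_exists_in => /forall_inP fixv.
  case/andP: sgS => /negP[]; apply/eqP/act_inj => x; rewrite act1.
  move: x (Phi_span x); apply: span_set_ind => [|a u x uP IHx]; first by rewrite /act mul0mx.
  rewrite /act mulmxDl -scalemxAl -!/(act _ _) IHx.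
  by have := fixv u uP; rewrite negbK => /eqP ->.
have [w wE] : exists w, w = act v sg - v by eexists.
have w0 : w != 0 by rewrite wE subr_eq0.
have ww : B w w = 0 by rewrite wE shear_image_singular.
have vwE : v + w = act v sg by rewrite wE addrC subrK.
have vwP : v + w \in Phi by rewrite vwE PhiG.
have vw : B v w = 0.
  have := Phi_norm _ vwP; rewrite !bilE ww (Phi_norm _ vP) (symB w v) => E.
  by apply: (mulfI two); rewrite mulr0; apply: (addrI c); rewrite addr0 -[in RHS]E; ring.
have orthoC x y : B x y = 0 -> B y x = 0 by rewrite symB.
have Phi_conn x y : x \in Phi -> y \in Phi -> connect (linked B Phi) x y.
  apply: (Phi_connected ndB orthoC G_isom G_irr PhiG Phi_span S_gen S_drop S_order
    S0_sub S0_card Phi_n0).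
  have Bv : B v (v + w) = c by rewrite bilDr vw addr0 Phi_norm.
  exists v, (v + w); split=> //; first by rewrite connect1 // /linked vP vwP Bv.
  apply: contra vs => /sub_rVP[a aE]; have a1 : a = 1.
    by apply: (mulIf c0); rewrite mul1r -[RHS]Bv aE bilZr Phi_norm.
  by rewrite -vwE aE a1 scale1r.
have [u uP wu] := span_not_orthogonal ndB Phi_span w0.
have orb Theta : refl_closed B Phi Theta -> forall x y, B x x = B y y -> B x x != 0 ->
    (x \in Theta) = (y \in Theta).
  move=> Tcl x y; apply: (root_set_transitive two three symB F_prime c0 Phi_norm Phi_refl
    Phi_span Phi_conn vP vwP w0 ww _ Tcl).
  by exists u.
have Phi_full x : B x x = c -> x \in Phi.
  by move=> xc; rewrite (orb Phi Phi_refl x v1) ?xc.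
have [z zns zcov] := nonsquare_rep two.
have z0 : z != 0 by have := zns 0; rewrite expr0n.
have zc0 : z * c != 0 by rewrite mulf_neq0.
have orbN (Theta : {set 'rV[F]_n.+1}) :
    (forall t x, B t t = c -> x \in Theta -> refl B t x \in Theta) ->
    forall x y, B x x = B y y -> B x x != 0 -> (x \in Theta) = (y \in Theta).
  by move=> Tcl; apply: orb => t x /Phi_norm; apply: Tcl.
have cG : norm_reflections B c \subset G.
  apply/subsetP => g /norm_reflectionsP[t /Phi_full /rootsP[_ [h hG hE]] gE].
  by rewrite (acts_as_refl_inj gE hE).
have sq1 a : reflect (exists b, a = b ^+ 2) [exists b, a == b ^+ 2].
  by apply: (iffP existsP) => -[b /eqP E]; exists b => //; apply/eqP.
have sqz : sq_class (z * c) = - sq_class c.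
  rewrite /sq_class; case: (sq1 _) => [[d dE]|nzc]; case: (sq1 _) => [[b bE]|nc].
  - have b0 : b != 0 by apply: contraNneq c0 => b0; rewrite bE b0 expr0n.
    have := zns (d / b); rewrite expr_div_n -dE -bE mulfK ?eqxx //.
  - by rewrite opprK.
  - by [].
  - have [//|[b bE]] := zcov c c0.
    by case: nzc; exists (z * b); rewrite bE; ring.
have sq_pm : sq_class c = 1 \/ sq_class c = -1 by rewrite /sq_class; case: ifP; [left|right].
have n11 : (-1 : F) != 1 by rewrite eq_sym -subr_eq0 opprK -mulr2n.
have unique (K : {group {'GL_n.+1[F]}}) : norm_reflections B c \subset K ->
    K \subset isom_group B -> (forall g, g \in norm_reflections B (z * c) -> g \notin K) ->
    G = isom_group B :> {set _} \/ G = K :> {set _}.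
  exact: (isom_or_unique two symB ndB c0 zcov orbN z0 cG G_isom).
have cR g : g \in norm_reflections B c ->
    [/\ g \in isom_group B, spinor_norm B g = sq_class c & \det (GLval g) = -1].
  move=> gR; have [t tc gE] := norm_reflectionsP _ _ _ gR.
  have t0 : B t t != 0 by rewrite tc.
  have [-> ->] := spinor_refl t0 gE; rewrite tc; split=> //.
  exact: acts_as_refl_isom gE.
have zcR g : g \in norm_reflections B (z * c) ->
    spinor_norm B g = - sq_class c /\ \det (GLval g) = -1.
  move=> gR; have [t tc gE] := norm_reflectionsP _ _ _ gR.
  have t0 : B t t != 0 by rewrite tc.
  by have [-> ->] := spinor_refl t0 gE; rewrite tc sqz.
case: sq_pm => sqc.
  case: (unique (Group ker_spinor_group_set)) => [||g /zcR[gs _]| |].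
  - by apply/subsetP => g /cR[gB gs _]; apply/setIdP; rewrite gB gs sqc eqxx.
  - by apply/subsetP => g /setIdP[].
  - by apply/setIdP; rewrite gs sqc (negPf n11) => -[].
  - by constructor 1.
  - by constructor 2.
case: (unique (Group ker_spinor_det_group_set)) => [||g /zcR[gs gd]| |].
- by apply/subsetP => g /cR[gB gs gd]; apply/setIdP; rewrite gB gs gd sqc mulrNN mulr1 eqxx.
- by apply/subsetP => g /setIdP[].
- by apply/setIdP; rewrite gs gd sqc opprK mul1r (negPf n11) => -[].
- by constructor 1.
- by constructor 3.
Qed.

End Orthogonal.

(** * The theorem *)

Lemma Fp_natr (l : nat) (a : 'F_l) : exists k : nat, a = (k%:R)%R.
Proof. by exists a; rewrite natr_Zp. Qed.

Lemma Fp_natr_neq0 (l m : nat) : prime l -> (0 < m < l)%N -> ((m%:R : 'F_l) != 0)%R.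
Proof.
move=> l_prime /andP[m0 ml]; rewrite -(dvdn_pcharf (pchar_Fp l_prime)).
by apply: contraL ml => /dvdn_leq -/(_ m0); rewrite -leqNgt.
Qed.

Theorem theorem3p1 (l n r : nat) (B : ({biscalar 'rV['F_l]_n.+1})%R)
    (G : {group {'GL_n.+1['F_l]}}) (S S0 : {set {'GL_n.+1['F_l]}})
    (l_prime : prime l) (l_odd : odd l)
    (B_nondeg : pairing_nondegenerate B)
    (B_sym_or_alt : pairing_symmetric B \/ pairing_alternating B)
    (l_ge5 : pairing_symmetric B -> 5 <= l)
    (r_gt0 : 1 <= r)
    (G_isom : G \subset isom_group B)
    (G_irr : mx_irreducible (natural_repr G))
    (S_gen : <<S>>%g = G)
    (S0_sub : S0 \subset S)
    (S_drop : forall g, g \in S -> drop_dim g <= r)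
    (S_order : forall g, g \in S :\: S0 ->
       coprime #[g]%g (r.+1)`! \/ pseudoreflection g)
    (S0_card : 2 * r.+1 * #|S0| <= n.+1) :
  (pairing_symmetric B ->
     (exists2 g, g \in G & reflection g) ->
     (exists2 g, g \in G & isotropic_shear g) ->
     [\/ G = isom_group B :> {set _},
         G = ker_spinor B :> {set _} |
         G = ker_spinor_det B :> {set _}])
  /\
  (pairing_alternating B ->
     (exists2 g, g \in G & transvection g) ->
     G = isom_group B :> {set _}).
Proof.
have l_gt2 : 2 < l by rewrite odd_prime_gt2.
have two : ((2%:R : 'F_l) != 0)%R by rewrite Fp_natr_neq0.
have irr (U : 'M['F_l]_n.+1) :
    (forall g, g \in G -> ((U *m GLval g)%R <= U)%MS) -> U != 0%R -> ((1%:M)%R <= U)%MS.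
  move=> UG U0; have [_ full] := (mx_irrP _).1 G_irr.
  by rewrite sub1mx full //; apply/mxmoduleP => g gG; exact: UG.
split=> [symB refG shG | altB trG].
  have three : ((3%:R : 'F_l) != 0)%R.
    by rewrite Fp_natr_neq0 //= (leq_trans _ (l_ge5 symB)).
  exact: (orthogonal_or_spinor two three symB B_nondeg (@Fp_natr l) G_isom irr
    S_gen S_drop S_order S0_sub S0_card).
exact: (symplectic_full two altB B_nondeg (@Fp_natr l) G_isom irr
  S_gen S_drop S_order S0_sub S0_card).
Qed.
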